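(* Let $A$ and $B$ be free abelian groups of finite positive ranks, and let $B\,\mathrm{wr}\,A$ be their restricted wreath product (with base group $\bigoplus_{a\in A}B_a$ and active group $A$). Then the group $B\,\mathrm{wr}\,A$ is regularly injectively bi-interpretable with the ring of integers $\mathbb{Z}$.
   Context: Groups are structures in the language $\{\cdot,{}^{-1},1\}$; $\mathbb{Z}$ is a structure in the language of rings $\{+,\cdot,0,1\}$. All formulas are first-order. Interpretations. Let $\mathbb{A},\mathbb{B}$ be structures in languages $L(\mathbb A),L(\mathbb B)$. An interpretation code $\Gamma$ (of $L(\mathbb A)$-structures in $L(\mathbb B)$-structures, of dimension $n$) is a set of $L(\mathbb B)$-formulas $U_\Gamma(\bar x,\bar y)$, $E_\Gamma(\bar x_1,\bar x_2,\bar y)$, $Q_\Gamma(\bar x_1,\dots,\bar x_{t_Q},\bar y)$ for each symbol $Q\in L(\mathbb A)$, where the $\bar x,\bar x_i$ are $n$-tuples of variables and $\bar y$ is a tuple of parameter variables. For a tuple $p$ of elements of $\mathbb B$, write $\mathbb A\simeq\Gamma(\mathbb B,p)$ if, after substituting $\bar y\to p$, $U_\Gamma$ defines a set $A_\Gamma\subseteq \mathbb B^n$, $E_\Gamma$ defines an equivalence relation $\sim_\Gamma$ on $A_\Gamma$, and the $Q_\Gamma$ define (as full preimages of graphs) operations, predicates and constants on $A_\Gamma/{\sim_\Gamma}$ such that the resulting $L(\mathbb A)$-structure $\Gamma(\mathbb B,p)$ is isomorphic to $\mathbb A$. A coordinate map is a surjection $\mu_\Gamma:A_\Gamma\to\mathbb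 A$ inducing an isomorphism $\bar\mu_\Gamma:\Gamma(\mathbb B,p)\to\mathbb A$. The interpretation is injective if $\sim_\Gamma$ is equality on $A_\Gamma$. Regular interpretations. $\mathbb A$ is regularly interpretable in $\mathbb B$ by a code $\Gamma$ and a parameter-free $L(\mathbb B)$-formula $\phi(\bar y)$, written $\mathbb A\simeq\Gamma(\mathbb B,\phi)$, if $\phi$ is satisfied by some tuple in $\mathbb B$ and $\mathbb A\simeq\Gamma(\mathbb B,p)$ for every tuple $p$ satisfying $\phi$ in $\mathbb B$. Composition. If $\mathbb A\simeq\Gamma(\mathbb B,\phi)$ and $\mathbb B\simeq\Delta(\mathbb A,\psi)$, then translating the formulas of $\Gamma$ via the code $\Delta$ gives a code $\Gamma\circ\Delta$ interpreting $\mathbb A$ in itself regularly, $\mathbb A\simeq(\Gamma\circ\Delta)(\mathbb A,\phi^* )$, where $\phi^*$ expresses that a parameter tuple consists of a tuple satisfying $\psi$ together with a tuple representing (in the corresponding copy of $\mathbb B$ interpreted by $\Delta$) parameters satisfying $\phi$. Similarly $\mathbb B\simeq(\Delta\circ\Gamma)(\mathbb B,\psi^* )$. Regular bi-interpretability. $\mathbb A$ and $\mathbb B$ are regularly bi-interpretable if (1) $\mathbb A\simeq\Gamma(\mathbb B,\phi)$ and $\mathbb B\simeq\Delta(\mathbb A,\psi)$ for some codes $\Gamma,\Delta$ and parameter-free formulas $\phi,\psi$; and (2) there is an $L(\mathbb A)$-formula $\theta(\bar y,x,\bar z)$ such that for every tuple $p^*$ satisfying $\phi^*$ in $\mathbb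 A$ the formula $\theta(\bar y,x,p^* )$ defines in $\mathbb A$ (the coordinate map of) an isomorphism $\bar\mu_{\Gamma\circ\Delta}:(\Gamma\circ\Delta)(\mathbb A,p^* )\to\mathbb A$, and there is an $L(\mathbb B)$-formula $\sigma(\bar u,x,\bar v)$ such that for every tuple $q^*$ satisfying $\psi^*$ in $\mathbb B$ the formula $\sigma(\bar u,x,q^* )$ defines in $\mathbb B$ (the coordinate map of) an isomorphism $\bar\mu_{\Delta\circ\Gamma}:(\Delta\circ\Gamma)(\mathbb B,q^* )\to\mathbb B$. The bi-interpretation is injective if both interpretations $\Gamma$ and $\Delta$ are injective. *)

(* Defs.v *)
From HB Require Import structures.
From mathcomp Require Import all_boot all_algebra finmap monalg.

Set Implicit Arguments.
Unset Strict Implicit.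
Unset Printing Implicit Defensive.

Import GRing.Theory.

Record language := Language {
  funsym : Type;
  farity : funsym -> nat;
  relsym : Type;
  rarity : relsym -> nat }.

Arguments farity {l} _.
Arguments rarity {l} _.

Record structure (L : language) := Structure {
  carrier :> Type;
  finterp : forall f : funsym L, ('I_(farity f) -> carrier) -> carrier;
  rinterp : forall r : relsym L, ('I_(rarity r) -> carrier) -> Prop }.

Arguments finterp {L} s f _.
Arguments rinterp {L} s r _.

(** Here and below an [n]-tuple over [T] is a function ['I_n -> T]. *)
Inductive term (L : language) (X : Type) :=
| Var of X
| App (f : funsym L) of 'I_(farity f) -> term L X.

(** [formula L X] is the type of formulas all of whose free variables lie in
    [X]; a quantifier binds the variable [None : option X]. *)
Inductive formula (L : language) (X : Type) :=
| Bot
| Eq of term L X & term L X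
| Rel (r : relsym L) of 'I_(rarity r) -> term L X
| Imp of formula L X & formula L X
| And of formula L X & formula L X
| Or of formula L X & formula L X
| All of formula L (option X)
| Ex of formula L (option X).

Arguments Var {L X} _.
Arguments App {L X} f _.
Arguments Bot {L X}.
Arguments Eq {L X} _ _.
Arguments Rel {L X} r _.
Arguments Imp {L X} _ _.
Arguments And {L X} _ _.
Arguments Or {L X} _ _.
Arguments All {L X} _.
Arguments Ex {L X} _.

Definition extend (X T : Type) (e : X -> T) (a : T) (v : option X) : T :=
  if v is Some x then e x else a.

Definition sumenv (X Y T : Type) (e : X -> T) (p : Y -> T) (v : X + Y) : T :=
  match v with inl x => e x | inr y => p y end.

Section Semantics.
Context {L : language} (M : structure L).

Fixpoint eval (X : Type) (e : X -> M) (t : term L X) : M :=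
  match t with
  | Var x => e x
  | App f ts => finterp M f (fun i => eval e (ts i))
  end.

Fixpoint sat (X : Type) (e : X -> M) (phi : formula L X) : Prop :=
  match phi with
  | Bot => False
  | Eq t u => eval e t = eval e u
  | Rel r ts => rinterp M r (fun i => eval e (ts i))
  | Imp p q => sat e p -> sat e q
  | And p q => sat e p /\ sat e q
  | Or p q => sat e p \/ sat e q
  | All p => forall a, sat (extend e a) p
  | Ex p => exists a, sat (extend e a) p
  end.

End Semantics.

Section Syntax.
Context {L : language}.

Fixpoint trename (X Y : Type) (h : X -> Y) (t : term L X) : term L Y :=
  match t with
  | Var x => Var (h x)
  | App f ts => App f (fun i => trename h (ts i))
  end.

Fixpoint rename (X Y : Type) (h : X -> Y) (phi : formula L X) : formula L Y :=
  match phi with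
  | Bot => Bot
  | Eq t u => Eq (trename h t) (trename h u)
  | Rel r ts => Rel r (fun i => trename h (ts i))
  | Imp p q => Imp (rename h p) (rename h q)
  | And p q => And (rename h p) (rename h q)
  | Or p q => Or (rename h p) (rename h q)
  | All p => All (rename (omap h) p)
  | Ex p => Ex (rename (omap h) p)
  end.

Definition Conj n (X : Type) (F : 'I_n -> formula L X) : formula L X :=
  \big[And/Imp Bot Bot]_(i < n) F i.

Definition drop_block0 (X : Type) (v : 'I_0 + X) : X :=
  match v with
  | inl i => False_rect X (notF (ltn_ord i))
  | inr x => x
  end.

Definition push_block n (X : Type) (v : 'I_n.+1 + X) : option ('I_n + X) :=
  match v with
  | inl i => omap inl (unlift ord0 i)
  | inr x => Some (inr x)
  end.

(** Quantification of a whole block of [n] variables; variable [ord0] of the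
    block is bound by the innermost quantifier. *)
Fixpoint AllN n (X : Type) : formula L ('I_n + X) -> formula L X :=
  match n with
  | 0 => rename (@drop_block0 X)
  | _.+1 => fun phi => AllN (All (rename (@push_block _ X) phi))
  end.

Fixpoint ExN n (X : Type) : formula L ('I_n + X) -> formula L X :=
  match n with
  | 0 => rename (@drop_block0 X)
  | _.+1 => fun phi => ExN (Ex (rename (@push_block _ X) phi))
  end.

End Syntax.

(** A code of [LA]-structures in [LB]-structures.  The variables of
    [cF f] stand for the argument tuples, the value tuple and the
    parameters, in this order. *)
Record code (LA LB : language) := Code {
  cdim : nat;
  cpar : nat;
  cU : formula LB ('I_cdim + 'I_cpar);
  cE : formula LB (('I_cdim + 'I_cdim) + 'I_cpar);
  cF : forall f : funsym LA,
         formula LB (('I_(farity f) * 'I_cdim + 'I_cdim) + 'I_cpar);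
  cR : forall r : relsym LA, formula LB ('I_(rarity r) * 'I_cdim + 'I_cpar) }.

Arguments cF {LA LB} c f.
Arguments cR {LA LB} c r.

Section Interpretation.
Context {LA LB : language} (G : code LA LB).
Context (B : structure LB) (p : 'I_(cpar G) -> B).

(** [cE], [cF] and [cR] are only ever read on tuples of [dom]; their values
    elsewhere are irrelevant. *)
Definition dom := {x : 'I_(cdim G) -> B | sat (sumenv x p) (cU G)}.

Definition flat t (xs : 'I_t -> dom) (v : 'I_t * 'I_(cdim G)) : B :=
  sval (xs v.1) v.2.

Definition dom_eq (x y : dom) : Prop :=
  sat (sumenv (sumenv (sval x) (sval y)) p) (cE G).

Definition dom_fun (f : funsym LA) (xs : 'I_(farity f) -> dom) (y : dom) : Prop :=
  sat (sumenv (sumenv (flat xs) (sval y)) p) (cF G f).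

Definition dom_rel (r : relsym LA) (xs : 'I_(rarity r) -> dom) : Prop :=
  sat (sumenv (flat xs) p) (cR G r).

(** The code defines an [LA]-structure on the quotient of [dom] by
    [dom_eq]. *)
Record defines_structure : Prop := DefinesStructure {
  dom_eq_refl : forall x, dom_eq x x;
  dom_eq_sym : forall x y, dom_eq x y -> dom_eq y x;
  dom_eq_trans : forall x y z, dom_eq x y -> dom_eq y z -> dom_eq x z;
  dom_fun_congr : forall (f : funsym LA) (xs xs' : 'I_(farity f) -> dom) y y',
    (forall i, dom_eq (xs i) (xs' i)) -> dom_eq y y' ->
    dom_fun xs y -> dom_fun xs' y';
  dom_fun_total : forall (f : funsym LA) (xs : 'I_(farity f) -> dom),
    exists y, dom_fun xs y;
  dom_fun_unique : forall (f : funsym LA) (xs : 'I_(farity f) -> dom) y y',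
    dom_fun xs y -> dom_fun xs y' -> dom_eq y y';
  dom_rel_congr : forall (r : relsym LA) (xs xs' : 'I_(rarity r) -> dom),
    (forall i, dom_eq (xs i) (xs' i)) -> dom_rel xs -> dom_rel xs' }.

(** [mu] induces an isomorphism from that quotient structure onto [A]. *)
Record coordinate_map (A : structure LA) (mu : dom -> A) : Prop :=
  CoordinateMap {
  coord_surj : forall a, exists x, mu x = a;
  coord_eq : forall x y, dom_eq x y <-> mu x = mu y;
  coord_fun : forall (f : funsym LA) (xs : 'I_(farity f) -> dom) y,
    dom_fun xs y <-> finterp A f (fun i => mu (xs i)) = mu y;
  coord_rel : forall (r : relsym LA) (xs : 'I_(rarity r) -> dom),
    dom_rel xs <-> rinterp A r (fun i => mu (xs i)) }.

Definition interprets (A : structure LA) : Prop :=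
  defines_structure /\ exists mu : dom -> A, coordinate_map mu.

Definition injective_at : Prop :=
  forall x y : dom, dom_eq x y <-> sval x =1 sval y.

(** [T] is exactly the graph of [mu]; in particular it is false outside
    [dom]. *)
Definition defines_coordinate_map (A : structure LA)
    (mu : dom -> A) (T : ('I_(cdim G) -> B) -> A -> Prop) : Prop :=
  forall y x, T y x <-> exists Uy : sat (sumenv y p) (cU G),
    mu (exist _ y Uy) = x.

End Interpretation.

Definition regularly_interpretable (LA LB : language) (A : structure LA)
    (B : structure LB) (G : code LA LB) (phi : formula LB 'I_(cpar G)) : Prop :=
  (exists p : 'I_(cpar G) -> B, sat p phi) /\
  (forall p : 'I_(cpar G) -> B, sat p phi -> interprets p A).

Definition injective_interpretation (LA LB : language)
    (B : structure LB) (G : code LA LB) (phi : formula LB 'I_(cpar G)) : Prop :=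
  forall p : 'I_(cpar G) -> B, sat p phi -> injective_at p.

Section Translation.
Context {LB LC : language} (D : code LB LC).
Local Notation m := (cdim D).
Local Notation l := (cpar D).

(** Each variable [x : X] becomes the block of variables [inl (x, _)]. *)
Local Notation tvar X := (X * 'I_m + 'I_l)%type.

Definition open_var (X : Type) (v : tvar (option X)) : 'I_m + tvar X :=
  match v with
  | inl (Some x, j) => inr (inl (x, j))
  | inl (None, j) => inl j
  | inr k => inr (inr k)
  end.

Definition U_head (X : Type) (v : 'I_m + 'I_l) : 'I_m + tvar X :=
  match v with inl j => inl j | inr k => inr (inr k) end.

Definition AllU (X : Type) (phi : formula LC ('I_m + tvar X)) : formula LC (tvar X) :=
  AllN (Imp (rename (@U_head X) (cU D)) phi).

Definition ExU (X : Type) (phi : formula LC ('I_m + tvar X)) : formula LC (tvar X) :=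
  ExN (And (rename (@U_head X) (cU D)) phi).

Section Arguments.
Context (a : nat) (X V : Type) (emb : tvar X -> V).

Definition arg_U_var (i : 'I_a) (v : 'I_m + 'I_l) : 'I_(a * m) + V :=
  match v with
  | inl j => inl (mxvec_index i j)
  | inr k => inr (emb (inr k))
  end.

Definition arg_var (i : 'I_a) (v : 'I_m + tvar X) : 'I_(a * m) + V :=
  match v with
  | inl j => inl (mxvec_index i j)
  | inr x => inr (emb x)
  end.

(** "There are [w_0, ..., w_(a-1)] in the domain such that [w_i] is a value of
    the [i]-th argument and [Q (w_0, ..., w_(a-1))]". *)
Definition ExArgs (ts : 'I_a -> formula LC ('I_m + tvar X))
    (Q : formula LC ('I_(a * m) + V)) : formula LC V :=
  ExN (And (Conj (fun i => And (rename (arg_U_var i) (cU D))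
                               (rename (arg_var i) (ts i)))) Q).

End Arguments.

Definition E_var (X : Type) (x : X) (v : ('I_m + 'I_m) + 'I_l) : 'I_m + tvar X :=
  match v with
  | inl (inl j) => inr (inl (x, j))
  | inl (inr j) => inl j
  | inr k => inr (inr k)
  end.

Definition F_var a (X : Type) (v : ('I_a * 'I_m + 'I_m) + 'I_l) :
    'I_(a * m) + ('I_m + tvar X) :=
  match v with
  | inl (inl (i, j)) => inl (mxvec_index i j)
  | inl (inr j) => inr (inl j)
  | inr k => inr (inr (inr k))
  end.

Definition R_var a (X : Type) (v : 'I_a * 'I_m + 'I_l) : 'I_(a * m) + tvar X :=
  match v with
  | inl (i, j) => inl (mxvec_index i j)
  | inr k => inr (inr k)
  end.

(** "The tuple [inl _] represents the value of [t]". *)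
Fixpoint ttranslate (X : Type) (t : term LB X) : formula LC ('I_m + tvar X) :=
  match t with
  | Var x => rename (E_var x) (cE D)
  | App f ts => ExArgs (fun v => inr v) (fun i => ttranslate (ts i))
                  (rename (@F_var _ X) (cF D f))
  end.

Fixpoint translate (X : Type) (phi : formula LB X) : formula LC (tvar X) :=
  match phi with
  | Bot => Bot
  | Eq t u => ExU (And (ttranslate t) (ttranslate u))
  | Rel r ts => ExArgs id (fun i => ttranslate (ts i))
                  (rename (@R_var _ X) (cR D r))
  | Imp p q => Imp (translate p) (translate q)
  | And p q => And (translate p) (translate q)
  | Or p q => Or (translate p) (translate q)
  | All p => AllU (rename (@open_var X) (translate p))
  | Ex p => ExU (rename (@open_var X) (translate p))
  end.

End Translation.

Section Composition.
Context {LA LB LC : language} (G : code LA LB) (D : code LB LC).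
Local Notation n := (cdim G).
Local Notation k := (cpar G).
Local Notation m := (cdim D).
Local Notation l := (cpar D).

(** Parameters of the composite: the parameters of [D], then [k] blocks of
    length [m] representing the parameters of [G]. *)
Definition comp_par (v : 'I_k * 'I_m + 'I_l) : 'I_(l + k * m) :=
  match v with
  | inl (i, j) => rshift l (mxvec_index i j)
  | inr h => lshift (k * m) h
  end.

Definition comp_var (S T : Type) (g : S -> 'I_m -> T) (v : (S + 'I_k) * 'I_m + 'I_l) :
    T + 'I_(l + k * m) :=
  match v with
  | inl (inl s, j) => inl (g s j)
  | inl (inr i, j) => inr (comp_par (inl (i, j)))
  | inr h => inr (comp_par (inr h))
  end.

Definition comp_point_var (i : 'I_n) (v : 'I_m + 'I_l) :
    'I_(n * m) + 'I_(l + k * m) :=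
  match v with
  | inl j => inl (mxvec_index i j)
  | inr h => inr (comp_par (inr h))
  end.

Definition comp_pair (s : 'I_n + 'I_n) (j : 'I_m) : 'I_(n * m) + 'I_(n * m) :=
  match s with
  | inl i => inl (mxvec_index i j)
  | inr i => inr (mxvec_index i j)
  end.

Definition comp_args t (s : 'I_t * 'I_n) (j : 'I_m) : 'I_t * 'I_(n * m) :=
  (s.1, mxvec_index s.2 j).

Definition comp_graph t (s : 'I_t * 'I_n + 'I_n) (j : 'I_m) :
    'I_t * 'I_(n * m) + 'I_(n * m) :=
  match s with
  | inl s' => inl (comp_args s' j)
  | inr i => inr (mxvec_index i j)
  end.

Definition comp_code : code LA LC := {|
  cdim := n * m;
  cpar := l + k * m;
  cU := And (Conj (fun i => rename (comp_point_var i) (cU D)))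
            (rename (comp_var (fun i j => mxvec_index i j))
               (translate D (cU G)));
  cE := rename (comp_var comp_pair) (translate D (cE G));
  cF := fun f => rename (comp_var (@comp_graph _)) (translate D (cF G f));
  cR := fun r => rename (comp_var (@comp_args _)) (translate D (cR G r)) |}.

Definition comp_par_var (i : 'I_k) (v : 'I_m + 'I_l) : 'I_(l + k * m) :=
  match v with
  | inl j => comp_par (inl (i, j))
  | inr h => comp_par (inr h)
  end.

(** The formula written phi^* when [phi] and [psi] select the parameters of
    [G] and [D]. *)
Definition comp_param (phi : formula LB 'I_k) (psi : formula LC 'I_l) :
    formula LC 'I_(cpar comp_code) :=
  And (rename (fun h => comp_par (inr h)) psi)
      (And (Conj (fun i => rename (comp_par_var i) (cU D)))
           (rename comp_par (translate D phi))).

End Composition.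

Definition definable_self_isomorphism (L : language) (A : structure L)
    (G : code L L) (phi : formula L 'I_(cpar G)) : Prop :=
  exists theta : formula L (('I_(cdim G) + unit) + 'I_(cpar G)),
    forall p : 'I_(cpar G) -> A, sat p phi ->
      exists2 mu : dom p -> A, coordinate_map mu &
        defines_coordinate_map mu
          (fun y x => sat (sumenv (sumenv y (fun=> x)) p) theta).

Definition regular_bi_interpretation (LA LB : language)
    (A : structure LA) (B : structure LB)
    (G : code LA LB) (phi : formula LB 'I_(cpar G))
    (D : code LB LA) (psi : formula LA 'I_(cpar D)) : Prop :=
  [/\ regularly_interpretable A B phi,
      regularly_interpretable B A psi,
      definable_self_isomorphism A (comp_param phi psi) &
      definable_self_isomorphism B (comp_param psi phi)].

Definition regularly_injectively_bi_interpretable (LA LB : language)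
    (A : structure LA) (B : structure LB) : Prop :=
  exists (G : code LA LB) (phi : formula LB 'I_(cpar G))
         (D : code LB LA) (psi : formula LA 'I_(cpar D)),
    [/\ regular_bi_interpretation A B phi psi,
        injective_interpretation B phi &
        injective_interpretation A psi].

Inductive group_symbol := GMul | GInv | GOne.

Definition group_arity (s : group_symbol) : nat :=
  match s with GMul => 2 | GInv => 1 | GOne => 0 end.

Definition group_language : language :=
  @Language group_symbol group_arity void (fun r => match r with end).

Definition group_structure (G : groupType) : structure group_language :=
  @Structure group_language G
    (fun f => match f return ('I_(group_arity f) -> G) -> G with
              | GMul => fun x => (x ord0 * x ord_max)%g
              | GInv => fun x => (x ord0)^-1%g
              | GOne => fun=> 1%g
              end)
    (fun r => match r with end).

Inductive ring_symbol := RAdd | RMul | RZero | ROne.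

Definition ring_arity (s : ring_symbol) : nat :=
  match s with RAdd | RMul => 2 | RZero | ROne => 0 end.

Definition ring_language : language :=
  @Language ring_symbol ring_arity void (fun r => match r with end).

Definition ring_structure (R : pzSemiRingType) : structure ring_language :=
  @Structure ring_language R
    (fun f => match f return ('I_(ring_arity f) -> R) -> R with
              | RAdd => fun x => (x ord0 + x ord_max)%R
              | RMul => fun x => (x ord0 * x ord_max)%R
              | RZero => fun=> 0%R
              | ROne => fun=> 1%R
              end)
    (fun r => match r with end).

Local Open Scope ring_scope.

Definition free_abelian_of_rank (A : zmodType) (n : nat) : Prop :=
  exists b : 'I_n -> A,
    bijective (fun c : {ffun 'I_n -> int} => \sum_(i < n) b i *~ c i).

Section Wreath.
Context (B A : zmodType).

(** [{malg B[A]}] is the group of finitely supported functions [A -> B], that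
    is, the direct sum of copies of [B] indexed by [A]. *)
Record wreath := Wreath { wr_base : {malg B[A]}; wr_top : A }.

(** [a] acts on [g] by [(a . g) x = g (x - a)]; see [shiftE]. *)
Definition shift (a : A) (g : {malg B[A]}) : {malg B[A]} :=
  [malg x in [fset (a + y)%R | y in msupp g]%fset => g@_(x - a)].

Lemma shiftE a g x : (shift a g)@_x = g@_(x - a).
Proof.
rewrite mcoeffE; case: imfsetP => //= nx; apply/esym/mcoeff_outdom.
by apply/negP => xs; apply: nx; exists (x - a) => //; rewrite addrC subrK.
Qed.

Definition wr_mul (u v : wreath) : wreath :=
  Wreath (wr_base u + shift (wr_top u) (wr_base v)) (wr_top u + wr_top v).

Definition wr_one : wreath := Wreath 0 0.

Definition wr_inv (u : wreath) : wreath :=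
  Wreath (- shift (- wr_top u) (wr_base u)) (- wr_top u).

Definition wr_pair (u : wreath) := (wr_base u, wr_top u).
Definition pair_wr (u : {malg B[A]} * A) := Wreath u.1 u.2.

Lemma wr_pairK : cancel wr_pair pair_wr.
Proof. by case. Qed.

Lemma wr_mulA : associative wr_mul.
Proof.
case=> [f a] [g b] [h c]; congr Wreath; rewrite /= ?addrA //.
by apply/malgP => x; rewrite !(mcoeffD, shiftE) opprD !addrA.
Qed.

Lemma wr_mul1 : left_id wr_one wr_mul.
Proof.
case=> [f a]; congr Wreath; rewrite /= ?add0r //.
by apply/malgP => x; rewrite shiftE subr0.
Qed.

Lemma wr_1mul : right_id wr_one wr_mul.
Proof.
case=> [f a]; congr Wreath; rewrite /= ?addr0 //.
by apply/malgP => x; rewrite mcoeffD shiftE mcoeff0 addr0.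
Qed.

Lemma wr_mulV : left_inverse wr_one wr_inv wr_mul.
Proof.
by case=> [f a]; congr Wreath; rewrite /= addNr.
Qed.

Lemma wr_Vmul : right_inverse wr_one wr_inv wr_mul.
Proof.
case=> [f a]; congr Wreath; rewrite /= ?subrr //.
apply/malgP => x.
by rewrite mcoeffD shiftE mcoeffN shiftE mcoeff0 opprK subrK subrr.
Qed.

HB.instance Definition _ := Choice.copy wreath (can_type wr_pairK).
HB.instance Definition _ :=
  isGroup.Build wreath wr_mulA wr_mul1 wr_1mul wr_mulV wr_Vmul.

End Wreath.

(* Main.v *)
(** Write [B wr A] as [N ><| A], where the base group [N] is a free module over the group
    ring [Z[A]].

    [N] consists of the elements commuting with all their conjugates.  For [t] outside [N]
    the powers of [t] are the [r] commuting with [t] such that [(r - 1) N] is contained in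
    [(t - 1) N], and since [(t^k - 1) / (t - 1) = k] modulo [t - 1] the multiplication of
    exponents is definable.  So every [t] outside [N] gives a copy of [Z].  Conversely
    finite sets of integers are coded by divisibility of products of the numbers [1 + x w],
    which makes finitely supported functions, hence [B wr A], interpretable in [Z]; keeping
    the least code of every function makes this injective.

    On the [Z] side the isomorphism is definable because [t^k] has [A]-component [k] times
    that of [t].  On the group side, an element [g] of [N] is determined by its values at the
    points where the generators [t_i] of [A] are replaced by nonzero integers [c_i], that is
    by the relations [w g = sum_j v_j e_j] modulo [sum_i (t_i - c_i) N].  These relations are
    definable in the group, because [y = k x] holds as soon as it holds modulo every
    [t^j - 1]; they are also definable in terms of codes, by translating the same formula.
    Comparing both decodes a code relative to a basis [t_i], [e_j].  The formula selecting
    the parameters asserts that this decoding is an isomorphism, so that only the standard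
    basis has to be checked. *)

Require Import Defs.
From mathcomp Require Import all_boot all_order all_algebra finmap monalg zify ring.
From Stdlib Require Import FunctionalExtensionality ProofIrrelevance ClassicalEpsilon.

Set Implicit Arguments.
Unset Strict Implicit.
Unset Printing Implicit Defensive.

Import Order.TTheory GRing.Theory Num.Theory.

(** * Definable relations *)

(** An element of [N] has unboundedly many coefficients, while a formula quantifies over tuples of
    fixed length. Setting [t_i = c_i] leaves, up to torsion, a quotient of [N] of rank [m], so that
    each value is a fixed number of integers: numerators [v_j] over a common denominator [w]. The
    denominator is forced, since the inverse of [t_i] acts as [1 / c_i].

    The two sides can be compared before any isomorphism between them is known because an exponent
    [k] lives in both: [t^k] is a group element, which enters the relations of the group itself, and
    a point of the copy of the integers, which enters the translated relations about codes.

    Multiplying an element of [N] by a variable exponent is not a group operation. This is why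
    congruences modulo [t^j - 1] appear: there multiplication by [k] is division of [t^(jk) - 1] by
    [t^j - 1].

    The values at all integer points determine [g] by a Vandermonde argument. The [A]-component of a
    group element is recovered in the same way, from the values of one generator of [N] translated
    by it. *)

Section Renaming.
Context {L : language} (M : structure L).

Lemma eval_rename X Y (h : X -> Y) (e : Y -> M) (t : term L X) :
  eval e (trename h t) = eval (e \o h) t.
Proof.
by elim: t => //= f ts IH; congr finterp; apply: functional_extensionality.
Qed.

Lemma extend_omap X Y (h : X -> Y) (e : Y -> M) a :
  extend e a \o omap h = extend (e \o h) a.
Proof. by apply: functional_extensionality => -[]. Qed.

Lemma sat_rename X (phi : formula L X) Y (h : X -> Y) (e : Y -> M) :
  sat e (rename h phi) <-> sat (e \o h) phi.
Proof.
elim: phi Y h e => {X} [X|X t u|X r ts|X p IHp q IHq|X p IHp q IHq|X p IHp q IHq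
  |X p IH|X p IH] Y h e //=.
- by rewrite !eval_rename.
- suff -> : (fun i => eval e (trename h (ts i)))
    = (fun i => eval (e \o h) (ts i)) by [].
  by apply: functional_extensionality => i; rewrite eval_rename.
- by rewrite IHp IHq.
- by rewrite IHp IHq.
- by rewrite IHp IHq.
- by split=> H a; move: (H a); rewrite IH extend_omap.
- by split=> -[a Ha]; exists a; move: Ha; rewrite IH extend_omap.
Qed.

Lemma sat_ExE X (p : formula L (option X)) (e : X -> M) :
  sat e (Ex p) <-> exists a, sat (extend e a) p.
Proof. by []. Qed.

Lemma sat_AllE X (p : formula L (option X)) (e : X -> M) :
  sat e (All p) <-> forall a, sat (extend e a) p.
Proof. by []. Qed.

Lemma sat_AndE X (p q : formula L X) (e : X -> M) :
  sat e (And p q) <-> sat e p /\ sat e q.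
Proof. by []. Qed.

Lemma sat_ImpE X (p q : formula L X) (e : X -> M) :
  sat e (Imp p q) <-> (sat e p -> sat e q).
Proof. by []. Qed.

Lemma sat_Conj n X (F : 'I_n -> formula L X) (e : X -> M) :
  sat e (Conj F) <-> forall i, sat e (F i).
Proof.
rewrite /Conj; split.
- move=> H i; move: H (mem_index_enum i).
  elim: (index_enum _) => // j s IH; rewrite big_cons inE /= => -[Hj Hs].
  by case/orP=> [/eqP-> //|/IH]; apply.
- by move=> H; elim/big_rec: _ => //= i phi _ sphi; split.
Qed.

Lemma extend_push n X (e : X -> M) (a : 'I_n -> M) b :
  extend (sumenv a e) b \o @push_block n X
  = sumenv (fun i => if unlift ord0 i is Some j then a j else b) e.
Proof.
apply: functional_extensionality => -[i|x] //=.
by case: (unlift ord0 i).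
Qed.

Lemma tuple_consK n T (a : 'I_n.+1 -> T) :
  (fun i => if unlift ord0 i is Some j then a (lift ord0 j) else a ord0) = a.
Proof. by apply: functional_extensionality => i; case: unliftP => [j|] ->. Qed.

Lemma drop_blockE X (e : X -> M) (a : 'I_0 -> M) :
  e \o @drop_block0 X = sumenv a e.
Proof. by apply: functional_extensionality => -[[]|]. Qed.

Lemma sat_ExN n X (phi : formula L ('I_n + X)) (e : X -> M) :
  sat e (ExN phi) <-> exists a : 'I_n -> M, sat (sumenv a e) phi.
Proof.
elim: n phi => [|n IH] phi /=.
  rewrite sat_rename; split=> [H|[a]]; last by rewrite -drop_blockE.
  exists (fun i : 'I_0 => False_rect _ (notF (ltn_ord i))).
  by rewrite -drop_blockE.
rewrite IH; split=> [[a Hb]|[a Ha]].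
  move/sat_ExE: Hb => [b Hb]; move: Hb; rewrite sat_rename extend_push => H; eexists; exact: H.
exists (fun j => a (lift ord0 j)); apply/sat_ExE; exists (a ord0).
by rewrite sat_rename extend_push tuple_consK.
Qed.

Lemma sat_AllN n X (phi : formula L ('I_n + X)) (e : X -> M) :
  sat e (AllN phi) <-> forall a : 'I_n -> M, sat (sumenv a e) phi.
Proof.
elim: n phi => [|n IH] phi /=.
  rewrite sat_rename; split=> [H a|]; first by rewrite -drop_blockE.
  move/(_ (fun i : 'I_0 => False_rect _ (notF (ltn_ord i)))).
  by rewrite -drop_blockE.
rewrite IH; split=> H a.
  have /sat_AllE/(_ (a ord0)) := H (fun j => a (lift ord0 j)).
  by rewrite sat_rename extend_push tuple_consK.
by apply/sat_AllE => b; rewrite sat_rename extend_push; exact: H.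
Qed.

End Renaming.

Section Definability.
Context {L : language} (M : structure L).

(** Definability is semantic: the closure lemmas build formulas by the shape of the goal, and
    [formula_of] extracts one by choice when a code needs it. *)
Definition definable X (R : (X -> M) -> Prop) : Prop :=
  exists phi : formula L X, forall e, sat e phi <-> R e.

Definition tdefinable X (f : (X -> M) -> M) : Prop :=
  exists t : term L X, forall e, eval e t = f e.

Lemma tdef_var X (x : X) : tdefinable (fun e => e x).
Proof. by exists (Var x). Qed.

Lemma tdef_rename X Y (h : X -> Y) (f : (X -> M) -> M) :
  tdefinable f -> tdefinable (fun e => f (fun x => e (h x))).
Proof.
by case=> t Ht; exists (trename h t) => e; rewrite eval_rename -Ht.
Qed.

Lemma tdef_app X (f : funsym L) (ts : 'I_(farity f) -> (X -> M) -> M) :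
  (forall i, tdefinable (ts i)) ->
  tdefinable (fun e => finterp M f (fun i => ts i e)).
Proof.
move=> H; pose t i := proj1_sig (constructive_indefinite_description _ (H i)).
exists (App f t) => e /=; congr finterp; apply: functional_extensionality => i.
exact: (proj2_sig (constructive_indefinite_description _ (H i))).
Qed.

Lemma def_ext X (R S : (X -> M) -> Prop) :
  (forall e, R e <-> S e) -> definable R -> definable S.
Proof. by move=> RS [phi H]; exists phi => e; rewrite H RS. Qed.

Lemma def_rename X Y (h : X -> Y) (R : (X -> M) -> Prop) :
  definable R -> definable (fun e => R (fun x => e (h x))).
Proof. by case=> phi H; exists (rename h phi) => e; rewrite sat_rename H. Qed.

Lemma def_false X : definable (fun _ : X -> M => False).
Proof. by exists Bot. Qed.

Lemma def_true X : definable (fun _ : X -> M => True).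
Proof. by exists (Imp Bot Bot) => e; split=> //= _. Qed.

Lemma def_eq X (f g : (X -> M) -> M) :
  tdefinable f -> tdefinable g -> definable (fun e => f e = g e).
Proof. by case=> t Ht [u Hu]; exists (Eq t u) => e; rewrite /= Ht Hu. Qed.

Lemma def_imp X (R S : (X -> M) -> Prop) :
  definable R -> definable S -> definable (fun e => R e -> S e).
Proof. by case=> p Hp [q Hq]; exists (Imp p q) => e; rewrite /= Hp Hq. Qed.

Lemma def_and X (R S : (X -> M) -> Prop) :
  definable R -> definable S -> definable (fun e => R e /\ S e).
Proof. by case=> p Hp [q Hq]; exists (And p q) => e; rewrite /= Hp Hq. Qed.

Lemma def_or X (R S : (X -> M) -> Prop) :
  definable R -> definable S -> definable (fun e => R e \/ S e).
Proof. by case=> p Hp [q Hq]; exists (Or p q) => e; rewrite /= Hp Hq. Qed.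

Lemma def_not X (R : (X -> M) -> Prop) :
  definable R -> definable (fun e => ~ R e).
Proof. by move=> H; exact: (def_imp H (def_false X)). Qed.

Lemma def_iff X (R S : (X -> M) -> Prop) :
  definable R -> definable S -> definable (fun e => R e <-> S e).
Proof. by move=> HR HS; exact: (def_and (def_imp HR HS) (def_imp HS HR)). Qed.

Lemma def_all X (R : (X -> M) -> M -> Prop) :
  definable (fun e : option X -> M => R (fun x => e (Some x)) (e None)) ->
  definable (fun e => forall a, R e a).
Proof.
case=> phi H; exists (All phi) => e /=.
by split=> Ha a; have := Ha a; rewrite H.
Qed.

Lemma def_ex X (R : (X -> M) -> M -> Prop) :
  definable (fun e : option X -> M => R (fun x => e (Some x)) (e None)) ->
  definable (fun e => exists a, R e a).
Proof.
case=> phi H; exists (Ex phi) => e /=.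
by split=> -[a Ha]; exists a; move: Ha; rewrite H.
Qed.

Lemma def_allT n X (R : (X -> M) -> ('I_n -> M) -> Prop) :
  definable (fun e : 'I_n + X -> M => R (fun x => e (inr x)) (fun i => e (inl i))) ->
  definable (fun e => forall a : 'I_n -> M, R e a).
Proof.
case=> phi H; exists (AllN phi) => e; rewrite sat_AllN.
by split=> Ha a; have := Ha a; rewrite H.
Qed.

Lemma def_exT n X (R : (X -> M) -> ('I_n -> M) -> Prop) :
  definable (fun e : 'I_n + X -> M => R (fun x => e (inr x)) (fun i => e (inl i))) ->
  definable (fun e => exists a : 'I_n -> M, R e a).
Proof.
case=> phi H; exists (ExN phi) => e; rewrite sat_ExN.
by split=> -[a Ha]; exists a; move: Ha; rewrite H.
Qed.

Lemma def_allI n X (R : 'I_n -> (X -> M) -> Prop) :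
  (forall i, definable (R i)) -> definable (fun e => forall i, R i e).
Proof.
move=> H; pose F i := proj1_sig (constructive_indefinite_description _ (H i)).
exists (Conj F) => e; rewrite sat_Conj.
by split=> He i; have := He i;
  rewrite (proj2_sig (constructive_indefinite_description _ (H i))).
Qed.

Lemma def_allF (S : finType) X (R : (X -> M) -> (S -> M) -> Prop) :
  definable (fun e : S + X -> M => R (fun x => e (inr x)) (fun i => e (inl i))) ->
  definable (fun e => forall a : S -> M, R e a).
Proof.
move=> H; apply: (@def_ext _ (fun e => forall a : 'I_#|S| -> M, R e (fun s => a (enum_rank s)))).
  move=> e; split=> He a; last exact: He.
  have := He (fun i => a (enum_val i)); congr (R e).
  by apply: functional_extensionality => s; rewrite enum_rankK.
apply: def_allT.
exact: (def_rename (fun v : S + X =>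
  match v with inl s => inl (enum_rank s) | inr x => inr x end) H).
Qed.

Lemma def_allS (I : finType) X (R : I -> (X -> M) -> Prop) :
  (forall i, definable (R i)) -> definable (fun e => forall i, R i e).
Proof.
move=> H; apply: (@def_ext _ (fun e => forall i : 'I_#|I|, R (enum_val i) e)).
  by move=> e; split=> He i; [rewrite -(enum_rankK i)|].
exact: def_allI.
Qed.

Lemma tdef_ext X (f g : (X -> M) -> M) : f =1 g -> tdefinable f -> tdefinable g.
Proof. by move=> fg [t Ht]; exists t => e; rewrite -fg. Qed.

(** Renaming puts only variables for variables. Substitution of terms is needed to insert constants,
    such as the codes of the standard generators, into a given formula. *)
Fixpoint tsubst (X Y : Type) (h : X -> term L Y) (t : term L X) : term L Y :=
  match t with
  | Var x => h x
  | App f ts => App f (fun i => tsubst h (ts i))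
  end.

Definition lift_subst (X Y : Type) (h : X -> term L Y) (v : option X) : term L (option Y) :=
  if v is Some x then trename Some (h x) else Var None.

Fixpoint fsubst (X Y : Type) (h : X -> term L Y) (phi : formula L X) : formula L Y :=
  match phi with
  | Bot => Bot
  | Eq t u => Eq (tsubst h t) (tsubst h u)
  | Rel r ts => Rel r (fun i => tsubst h (ts i))
  | Imp p q => Imp (fsubst h p) (fsubst h q)
  | And p q => And (fsubst h p) (fsubst h q)
  | Or p q => Or (fsubst h p) (fsubst h q)
  | All p => All (fsubst (lift_subst h) p)
  | Ex p => Ex (fsubst (lift_subst h) p)
  end.

Lemma eval_tsubst X Y (h : X -> term L Y) (t : term L X) (e : Y -> M) :
  eval e (tsubst h t) = eval (fun x => eval e (h x)) t.
Proof.
by elim: t => //= f ts IH; congr finterp; apply: functional_extensionality.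
Qed.

Lemma eval_lift_subst X Y (h : X -> term L Y) (e : Y -> M) a :
  (fun v => eval (extend e a) (lift_subst h v)) = extend (fun x => eval e (h x)) a.
Proof.
by apply: functional_extensionality => -[x|] //=; rewrite eval_rename.
Qed.

Lemma sat_fsubst X (phi : formula L X) Y (h : X -> term L Y) (e : Y -> M) :
  sat e (fsubst h phi) <-> sat (fun x => eval e (h x)) phi.
Proof.
elim: phi Y h e => {X} [X|X t u|X r ts|X p IHp q IHq|X p IHp q IHq|X p IHp q IHq
  |X p IH|X p IH] Y h e //=.
- by rewrite !eval_tsubst.
- suff -> : (fun i => eval e (tsubst h (ts i)))
    = (fun i => eval (fun x => eval e (h x)) (ts i)) by [].
  by apply: functional_extensionality => i; rewrite eval_tsubst.
- by rewrite IHp IHq.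
- by rewrite IHp IHq.
- by rewrite IHp IHq.
- by split=> H a; move: (H a); rewrite IH eval_lift_subst.
- by split=> -[a Ha]; exists a; move: Ha; rewrite IH eval_lift_subst.
Qed.

Lemma def_subst X Y (R : (X -> M) -> Prop) (f : X -> (Y -> M) -> M) :
  definable R -> (forall x, tdefinable (f x)) ->
  definable (fun e => R (fun x => f x e)).
Proof.
case=> phi HR Hf.
pose h x := proj1_sig (constructive_indefinite_description _ (Hf x)).
have hP x e : eval e (h x) = f x e.
  exact: (proj2_sig (constructive_indefinite_description _ (Hf x))).
exists (fsubst h phi) => e; rewrite sat_fsubst -HR.
by have -> : f^~ e = (fun x => eval e (h x)) by apply: functional_extensionality.
Qed.

Lemma def_sat X Y (phi : formula L X) (f : X -> (Y -> M) -> M) :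
  (forall x, tdefinable (f x)) -> definable (fun e => sat (fun x => f x e) phi).
Proof. by move=> Hf; apply: (def_subst (R := fun e => sat e phi)) => //; exists phi. Qed.

Lemma def_sat_sum X Y V (phi : formula L (X + Y)) (a : X -> V) (b : Y -> V) :
  definable (fun e : V -> M => sat (sumenv (fun x => e (a x)) (fun y => e (b y))) phi).
Proof.
apply: (@def_ext _ (fun e : V -> M => sat (fun v =>
  e (match v with inl x => a x | inr y => b y end)) phi)).
  move=> e; suff -> : sumenv (fun x => e (a x)) (fun y => e (b y)) =
    (fun v => e (match v with inl x => a x | inr y => b y end)) by [].
  by apply: functional_extensionality => -[].
by apply: (def_sat _ (f := fun v e => e (match v with inl x => a x | inr y => b y end)))
  => v; exact: tdef_var.
Qed.

Lemma def_sat_sum3 X Y W V (phi : formula L ((X + Y) + W)) (a : X -> V) (b : Y -> V) (c : W -> V) :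
  definable (fun e : V -> M =>
    sat (sumenv (sumenv (fun x => e (a x)) (fun y => e (b y))) (fun w => e (c w))) phi).
Proof.
apply: (@def_ext _ (fun e : V -> M => sat (fun v =>
  e (match v with inl (inl x) => a x | inl (inr y) => b y | inr w => c w end)) phi)).
  move=> e; set s := sumenv _ _.
  suff -> : s = (fun v =>
    e (match v with inl (inl x) => a x | inl (inr y) => b y | inr w => c w end)) by [].
  by apply: functional_extensionality => -[[]|].
by apply: (def_sat _ (f := fun v e =>
  e (match v with inl (inl x) => a x | inl (inr y) => b y | inr w => c w end)))
  => v; exact: tdef_var.
Qed.

End Definability.

(** Extension points of the tactics below, rebound whenever new closure lemmas become available. *)
Ltac def_atom := fail.
Ltac tdef_atom := fail.

Ltac tdef :=
  cbv beta;
  first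
  [ exact: tdef_var
  | match goal with
    | H : tdefinable ?f |- _ => exact: (tdef_rename _ H)
    | H : forall i, tdefinable (?f i) |- _ => exact: (tdef_rename _ (H _))
    end
  | tdef_atom ].

Ltac def_step :=
  cbv beta;
  match goal with
  | |- forall _, _ => intro
  | |- tdefinable _ => tdef
  | |- definable _ =>
    first [ def_atom | apply: def_and | apply: def_or | apply: def_not
          | apply: def_iff | apply: def_imp | apply: def_ex | apply: def_exT
          | apply: def_all | apply: def_allT | apply: def_allF | apply: def_allI | apply: def_eq
          | exact: def_true | exact: def_false ]
  end.

Ltac defn := repeat def_step.

(** * Translation along an interpretation *)

Definition unindex a m (k : 'I_(a * m)) : 'I_a * 'I_m :=
  enum_val (cast_ord (esym (mxvec_cast a m)) k).

Lemma mxvec_indexK a m (i : 'I_a) (j : 'I_m) : unindex (mxvec_index i j) = (i, j).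
Proof. by rewrite /unindex /mxvec_index cast_ordK enum_rankK. Qed.

Lemma unindexK a m (k : 'I_(a * m)) :
  mxvec_index (unindex k).1 (unindex k).2 = k.
Proof. by case/mxvec_indexP: k => i j; rewrite mxvec_indexK. Qed.

Section CoordinateMaps.
Context {LA LB : language} (G : code LA LB).
Context (B : structure LB) (p : 'I_(cpar G) -> B).

Definition in_dom (x : 'I_(cdim G) -> B) (Ux : sat (sumenv x p) (cU G)) : dom p :=
  exist _ x Ux.

Lemma dom_inj (x y : dom p) : sval x = sval y -> x = y.
Proof.
case: x y => [x Ux] [y Uy] /= xy; subst y.
by congr exist; exact: proof_irrelevance.
Qed.

(** All the congruence and function conditions are pulled back along [mu], so interpretations can be
    given by their coordinate maps alone. *)
Lemma coordinate_map_defines (A : structure LA) (mu : dom p -> A) :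
  coordinate_map mu -> defines_structure p.
Proof.
case=> surj eq_mu fun_mu rel_mu; split.
- by move=> x; apply/eq_mu.
- by move=> x y /eq_mu xy; apply/eq_mu.
- by move=> x y z /eq_mu xy /eq_mu yz; apply/eq_mu; rewrite xy.
- move=> f xs xs' y y' Exs /eq_mu Ey /fun_mu; rewrite Ey => H.
  apply/fun_mu; rewrite -H; congr finterp; apply: functional_extensionality => i.
  by apply/esym/eq_mu/Exs.
- by move=> f xs; have [y Hy] := surj (finterp A f (fun i => mu (xs i)));
    exists y; apply/fun_mu.
- by move=> f xs y y' /fun_mu E /fun_mu E'; apply/eq_mu; rewrite -E -E'.
- move=> r xs xs' Exs /rel_mu H; apply/rel_mu; move: H.
  suff -> : (fun i => mu (xs i)) = (fun i => mu (xs' i)) by [].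
  by apply: functional_extensionality => i; apply/eq_mu/Exs.
Qed.

Lemma coord_lift (A : structure LA) (mu : dom p -> A) I (a : I -> A) :
  coordinate_map mu -> exists x : I -> dom p, forall i, mu (x i) = a i.
Proof.
move=> muP; pose P i := constructive_indefinite_description _ (coord_surj muP (a i)).
by exists (fun i => proj1_sig (P i)) => i; exact: (proj2_sig (P i)).
Qed.

End CoordinateMaps.

Section Translation.
Context {LB LC : language} (D : code LB LC) (C : structure LC).
Context (p : 'I_(cpar D) -> C).
Local Notation m := (cdim D).
Local Notation l := (cpar D).

Definition tenv X (e : X -> dom p) : X * 'I_m + 'I_l -> C :=
  sumenv (fun v => sval (e v.1) v.2) p.

Lemma sat_ExArgs a X V (emb : X * 'I_m + 'I_l -> V)
    (ts : 'I_a -> formula LC ('I_m + (X * 'I_m + 'I_l)))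
    (Q : formula LC ('I_(a * m) + V)) (env : V -> C) :
  (forall k, env (emb (inr k)) = p k) ->
  sat env (ExArgs emb ts Q) <->
  exists w : 'I_a -> dom p,
    (forall i, sat (sumenv (sval (w i)) (env \o emb)) (ts i)) /\
    sat (sumenv (fun k => sval (w (unindex k).1) (unindex k).2) env) Q.
Proof.
move=> Ep; rewrite sat_ExN.
have Eu (w : 'I_(a * m) -> C) i :
    sumenv w env \o arg_U_var emb i = sumenv (fun j => w (mxvec_index i j)) p.
  by apply: functional_extensionality => -[j|k] //=.
have Ev (w : 'I_(a * m) -> C) i :
    sumenv w env \o arg_var emb i = sumenv (fun j => w (mxvec_index i j)) (env \o emb).
  by apply: functional_extensionality => -[j|k] //=.
split=> [[w] /sat_AndE[/sat_Conj Hw HQ]|[w [Hw HQ]]].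
  have Uw i : sat (sumenv (fun j => w (mxvec_index i j)) p) (cU D).
    by have /sat_AndE[] := Hw i; rewrite sat_rename Eu.
  exists (fun i => in_dom (Uw i)); split=> [i|] /=.
    by have /sat_AndE[_] := Hw i; rewrite sat_rename Ev.
  suff <- : w = (fun k => w (mxvec_index (unindex k).1 (unindex k).2)) by [].
  by apply: functional_extensionality => k; rewrite unindexK.
exists (fun k => sval (w (unindex k).1) (unindex k).2); apply/sat_AndE; split=> //.
apply/sat_Conj => i.
have E : (fun j => sval (w (unindex (mxvec_index i j)).1)
    (unindex (mxvec_index i j)).2) = sval (w i).
  by apply: functional_extensionality => j; rewrite mxvec_indexK.
apply/sat_AndE; split; rewrite sat_rename ?Eu ?Ev E; first exact: (svalP (w i)).
exact: Hw.
Qed.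

Context (B : structure LB) (nu : dom p -> B) (nuP : coordinate_map nu).

Lemma sat_ttranslate X (t : term LB X) (e : X -> dom p) (w : dom p) :
  sat (sumenv (sval w) (tenv e)) (ttranslate D t) <-> eval (nu \o e) t = nu w.
Proof.
elim: t w => [x|f ts IH] w /=.
  rewrite sat_rename; have := coord_eq nuP (e x) w; rewrite /dom_eq => <-.
  suff -> : sumenv (sval w) (tenv e) \o E_var (D:=D) x
    = sumenv (sumenv (sval (e x)) (sval w)) p by [].
  by apply: functional_extensionality => -[[j|j]|k].
rewrite sat_ExArgs //.
have E (v : 'I_(farity f) -> dom p) :
    sat (sumenv (fun k => sval (v (unindex k).1) (unindex k).2)
      (sumenv (sval w) (tenv e))) (rename (@F_var LB LC D _ X) (cF D f)) <->
    finterp B f (fun i => nu (v i)) = nu w.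
  rewrite sat_rename -(coord_fun nuP) /dom_fun.
  suff -> : sumenv (fun k => sval (v (unindex k).1) (unindex k).2)
      (sumenv (sval w) (tenv e)) \o (@F_var LB LC D _ X) =
      sumenv (sumenv (flat v) (sval w)) p by [].
  apply: functional_extensionality => -[[[i j]|j]|k] //=.
  by rewrite mxvec_indexK.
split=> [[v [Hv /E <-]]|H].
  congr finterp; apply: functional_extensionality => i.
  by apply/IH; have := Hv i.
have [v vP] := coord_lift (fun i => eval (nu \o e) (ts i)) nuP.
exists v; split=> [i|]; first by apply/IH; rewrite vP.
apply/E; rewrite -H; congr finterp; apply: functional_extensionality => i.
exact: vP.
Qed.

Lemma sat_AllU X (phi : formula LC ('I_m + (X * 'I_m + 'I_l))) (e : X -> dom p) :
  sat (tenv e) (AllU phi) <->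
  forall w : dom p, sat (sumenv (sval w) (tenv e)) phi.
Proof.
have E (a : 'I_m -> C) : sumenv a (tenv e) \o @U_head LB LC D X = sumenv a p.
  by apply: functional_extensionality => -[].
rewrite sat_AllN; split=> [H w|H a].
  by have /sat_ImpE := H (sval w); apply; rewrite sat_rename E; exact: (svalP w).
by apply/sat_ImpE; rewrite sat_rename E => Ua; exact: (H (in_dom Ua)).
Qed.

Lemma sat_ExU X (phi : formula LC ('I_m + (X * 'I_m + 'I_l))) (e : X -> dom p) :
  sat (tenv e) (ExU phi) <->
  exists w : dom p, sat (sumenv (sval w) (tenv e)) phi.
Proof.
have E (a : 'I_m -> C) : sumenv a (tenv e) \o @U_head LB LC D X = sumenv a p.
  by apply: functional_extensionality => -[].
rewrite sat_ExN; split=> [[a] /sat_AndE[]|[w Hw]].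
  by rewrite sat_rename E => Ua Ha; exists (in_dom Ua).
by exists (sval w); apply/sat_AndE; split; rewrite ?sat_rename ?E //; exact: (svalP w).
Qed.

Lemma sat_open X (phi : formula LC (option X * 'I_m + 'I_l)) (e : X -> dom p)
    (w : dom p) :
  sat (sumenv (sval w) (tenv e)) (rename (@open_var LB LC D X) phi)
  <-> sat (tenv (extend e w)) phi.
Proof.
rewrite sat_rename.
suff -> : sumenv (sval w) (tenv e) \o @open_var LB LC D X = tenv (extend e w) by [].
by apply: functional_extensionality => -[[[x|] j]|k].
Qed.

Lemma comp_extend X (e : X -> dom p) w : nu \o extend e w = extend (nu \o e) (nu w).
Proof. by apply: functional_extensionality => -[]. Qed.

(** The reduction property of interpretations. The relativised quantifiers range over all of [B]
    because [nu] is surjective. *)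
Lemma sat_translate X (phi : formula LB X) (e : X -> dom p) :
  sat (tenv e) (translate D phi) <-> sat (nu \o e) phi.
Proof.
elim: phi e => {X} [X|X t u|X r ts|X q IHq s IHs|X q IHq s IHs|X q IHq s IHs
  |X q IH|X q IH] e.
- by [].
- rewrite /= sat_ExU; split=> [[w] [/sat_ttranslate -> /sat_ttranslate ->] //|H].
  have [w Hw] := coord_surj nuP (eval (nu \o e) t).
  by exists w; split; apply/sat_ttranslate; rewrite -?H Hw.
- rewrite /= sat_ExArgs //.
  have E (v : 'I_(rarity r) -> dom p) :
    sat (sumenv (fun k => sval (v (unindex k).1) (unindex k).2) (tenv e))
      (rename (@R_var LB LC D _ X) (cR D r)) <-> rinterp B r (fun i => nu (v i)).
    rewrite sat_rename -(coord_rel nuP) /dom_rel.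
    suff -> : sumenv (fun k => sval (v (unindex k).1) (unindex k).2)
        (tenv e) \o (@R_var LB LC D _ X) = sumenv (flat v) p by [].
    by apply: functional_extensionality => -[[i j]|k] //=; rewrite mxvec_indexK.
  split=> [[v [Hv /E]]|H].
    suff -> : (fun i => nu (v i)) = (fun i => eval (nu \o e) (ts i)) by [].
    by apply: functional_extensionality => i; apply/esym/sat_ttranslate/Hv.
  have [v vP] := coord_lift (fun i => eval (nu \o e) (ts i)) nuP.
  exists v; split=> [i|]; first by apply/sat_ttranslate; rewrite vP.
  apply/E; move: H; congr rinterp.
  by apply: functional_extensionality => i.
- by rewrite /= IHq IHs.
- by rewrite /= IHq IHs.
- by rewrite /= IHq IHs.
- rewrite /= sat_AllU; split=> H b.
    have [w <-] := coord_surj nuP b.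
    by have /sat_open/IH := H w; rewrite comp_extend.
  by apply/sat_open/IH; rewrite comp_extend; exact: H.
- rewrite /= sat_ExU; split=> [[w /sat_open/IH]|[b Hb]].
    by rewrite comp_extend; exists (nu w).
  have [w Ew] := coord_surj nuP b; exists w.
  by apply/sat_open/IH; rewrite comp_extend Ew.
Qed.

End Translation.

(** * Composition of interpretations *)

Section Composition.
Context {LA LB LC : language} (G : code LA LB) (D : code LB LC).
Context (A : structure LA) (B : structure LB) (C : structure LC).
Local Notation n := (cdim G).
Local Notation k := (cpar G).
Local Notation m := (cdim D).
Local Notation l := (cpar D).
Context (r : 'I_(cpar (comp_code G D)) -> C).

Definition outer_par (h : 'I_l) : C := r (comp_par (inr h)).

Context (nu : dom outer_par -> B) (nuP : coordinate_map nu).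

Definition represents a (w : 'I_a -> 'I_m -> C) (ws : 'I_a -> dom outer_par) :=
  forall i j, sval (ws i) j = w i j.

Lemma representsP a (w : 'I_a -> 'I_m -> C) :
  (forall i, sat (sumenv (w i) outer_par) (cU D)) <-> exists ws, represents w ws.
Proof.
split=> [H|[ws Hws] i]; first by exists (fun i => in_dom (H i)).
suff -> : w i = sval (ws i) by exact: (svalP (ws i)).
by apply: functional_extensionality => j; rewrite Hws.
Qed.

Definition inner_par (q : 'I_k -> dom outer_par) :=
  represents (fun i j => r (comp_par (inl (i, j)))) q.

Lemma sat_comp_param (phi : formula LB 'I_k) (psi : formula LC 'I_l) :
  sat r (comp_param phi psi) <->
  sat outer_par psi /\ exists q, inner_par q /\ sat (nu \o q) phi.
Proof.
have E q : inner_par q -> sat (r \o comp_par (G:=G) (D:=D)) (translate D phi) <-> sat (nu \o q) phi.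
  move=> Hq; rewrite -(sat_translate nuP).
  suff -> : r \o comp_par (G:=G) (D:=D) = tenv q by [].
  by apply: functional_extensionality => -[[i j]|h] //=; rewrite Hq.
have E' i : r \o comp_par_var i =
    sumenv (fun j => r (comp_par (inl (i, j)))) outer_par.
  by apply: functional_extensionality => -[].
split=> [/sat_AndE[Hpsi /sat_AndE[/sat_Conj Hq Hphi]]|[Hpsi [q [Hq Hphi]]]].
  move: Hpsi Hphi; rewrite !sat_rename => Hpsi Hphi.
  have /representsP[q inq] i :
      sat (sumenv (fun j => r (comp_par (inl (i, j)))) outer_par) (cU D).
    by rewrite -E' -sat_rename; exact: Hq.
  by split=> //; exists q; rewrite -E.
apply/sat_AndE; split; first by rewrite sat_rename.
apply/sat_AndE; split; last by rewrite sat_rename (E q).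
apply/sat_Conj => i; rewrite sat_rename E'; move: i.
by apply/representsP; exists q.
Qed.

Context (q : 'I_k -> dom outer_par) (inq : inner_par q).

Lemma sat_comp_var S T (g : S -> 'I_m -> T) (phi : formula LB (S + 'I_k))
    (e : T -> C) (ys : S -> dom outer_par) :
  (forall s j, sval (ys s) j = e (g s j)) ->
  sat (sumenv e r) (rename (comp_var g) (translate D phi)) <->
  sat (sumenv (nu \o ys) (nu \o q)) phi.
Proof.
move=> Hys; rewrite sat_rename.
have -> : sumenv e r \o comp_var g = tenv (sumenv ys q).
  by apply: functional_extensionality => -[[[s|i] j]|h] //=;
    rewrite ?Hys // (inq i j).
rewrite (sat_translate nuP).
suff -> : nu \o sumenv ys q = sumenv (nu \o ys) (nu \o q) by [].
by apply: functional_extensionality => -[].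
Qed.

Definition blocks (y : 'I_(n * m) -> C) :=
  represents (fun i j => y (mxvec_index i j)).

Lemma sat_comp_U (y : 'I_(n * m) -> C) :
  sat (sumenv y r) (cU (comp_code G D)) <->
  exists ys, blocks y ys /\ sat (sumenv (nu \o ys) (nu \o q)) (cU G).
Proof.
have E i : sumenv y r \o comp_point_var i =
    sumenv (fun j => y (mxvec_index i j)) outer_par.
  by apply: functional_extensionality => -[].
split=> [/sat_AndE[/sat_Conj Hy HU]|[ys [Hys HU]]].
  have /representsP[ys Hys] i :
      sat (sumenv (fun j => y (mxvec_index i j)) outer_par) (cU D).
    by rewrite -E -sat_rename; exact: Hy.
  exists ys; split=> //; move: HU.
  by rewrite (@sat_comp_var _ _ _ _ _ ys).
apply/sat_AndE; split; last by rewrite (@sat_comp_var _ _ _ _ _ ys).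
apply/sat_Conj => i; rewrite sat_rename E; move: i.
by apply/representsP; exists ys.
Qed.

Lemma blocks_inj y ys ys' : blocks y ys -> blocks y ys' -> ys = ys'.
Proof.
move=> H H'; apply: functional_extensionality => i; apply: dom_inj.
by apply: functional_extensionality => j; rewrite H H'.
Qed.

Context (mu : dom (G := G) (nu \o q) -> A) (muP : coordinate_map mu).

(** Apply [nu] to every block, then [mu]; the blocks are chosen but unique by [blocks_inj]. The
    values of the composite map are recorded since its definability depends on them. *)
Lemma comp_coordinate_map :
  exists2 mu' : dom r -> A, coordinate_map mu' &
    forall (y : dom r) ys (Uy : sat (sumenv (nu \o ys) (nu \o q)) (cU G)),
      blocks (sval y) ys -> mu' y = mu (in_dom Uy).
Proof.
have spl (y : dom r) : exists ys, blocks (sval y) ys /\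
    sat (sumenv (nu \o ys) (nu \o q)) (cU G).
  by apply/sat_comp_U; exact: (svalP y).
pose ys y := proj1_sig (constructive_indefinite_description _ (spl y)).
have ysP (y : dom r) : blocks (sval y) (ys y) /\ sat (sumenv (nu \o (ys y)) (nu \o q)) (cU G).
  exact: (proj2_sig (constructive_indefinite_description _ (spl y))).
pose pt (y : dom r) : dom (G := G) (nu \o q) := in_dom (ysP y).2.
have ptE y i : sval (pt y) i = nu (ys y i) by [].
exists (fun y => mu (pt y)); last first.
  move=> y ys' Uy Hys'; congr mu; apply: dom_inj => /=.
  by rewrite (blocks_inj (ysP y).1 Hys').
split.
- move=> a; have [x <-] := coord_surj muP a.
  have [ws Hws] := coord_lift (sval x) nuP.
  pose y (v : 'I_(n * m)) := sval (ws (unindex v).1) (unindex v).2.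
  have Hy : blocks y ws by move=> i j; rewrite /y mxvec_indexK.
  have Ex : nu \o ws = sval x by apply: functional_extensionality => i; exact: Hws.
  have Uy : sat (sumenv y r) (cU (comp_code G D)).
    by apply/sat_comp_U; exists ws; split=> //; rewrite Ex; exact: (svalP x).
  exists (in_dom (G := comp_code G D) Uy); congr mu; apply: dom_inj; rewrite -Ex.
  apply: functional_extensionality => i; rewrite ptE /=; congr (nu (_ i)).
  exact: (blocks_inj (ysP (in_dom (G := comp_code G D) Uy)).1 Hy).
- move=> x y; rewrite -(coord_eq muP) /dom_eq.
  rewrite (@sat_comp_var _ _ _ _ _ (sumenv (ys x) (ys y))).
    suff -> : nu \o sumenv (ys x) (ys y) =
      sumenv (sval (pt x)) (sval (pt y)) by [].
    by apply: functional_extensionality => -[].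
  by move=> [i|i] j /=; rewrite (ysP _).1.
- move=> f xs y; rewrite -(coord_fun muP) /dom_fun.
  rewrite (@sat_comp_var _ _ _ _ _ (sumenv (fun s => ys (xs s.1) s.2) (ys y))).
    suff -> : nu \o sumenv (fun s => ys (xs s.1) s.2) (ys y) =
      sumenv (flat (fun i => pt (xs i))) (sval (pt y)) by [].
    by apply: functional_extensionality => -[].
  by move=> [[s i]|i] j /=; rewrite (ysP _).1.
- move=> R xs; rewrite -(coord_rel muP) /dom_rel.
  rewrite (@sat_comp_var _ _ _ _ _ (fun s => ys (xs s.1) s.2)) //.
  by move=> [s i] j /=; rewrite (ysP _).1.
Qed.

End Composition.

(** * Coding finite sets and functions in the ring of integers *)

Section IntegerArithmetic.
Local Open Scope ring_scope.
Local Notation Z := (ring_structure int).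

Lemma tdefZ_add X (f g : (X -> Z) -> Z) :
  tdefinable f -> tdefinable g -> tdefinable (fun e => f e + g e : Z).
Proof.
move=> [t Ht] [u Hu].
by exists (App (RAdd : funsym ring_language) (fun i : 'I_2 => if i == ord0 then t else u))
  => e /=; rewrite -Ht -Hu.
Qed.

Lemma tdefZ_mul X (f g : (X -> Z) -> Z) :
  tdefinable f -> tdefinable g -> tdefinable (fun e => f e * g e : Z).
Proof.
move=> [t Ht] [u Hu].
by exists (App (RMul : funsym ring_language) (fun i : 'I_2 => if i == ord0 then t else u))
  => e /=; rewrite -Ht -Hu.
Qed.

Lemma tdefZ_0 X : tdefinable (fun _ : X -> Z => 0 : Z).
Proof.
by exists (App (RZero : funsym ring_language) (fun i : 'I_0 => False_rect _ (notF (ltn_ord i)))).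
Qed.

Lemma tdefZ_1 X : tdefinable (fun _ : X -> Z => 1 : Z).
Proof.
by exists (App (ROne : funsym ring_language) (fun i : 'I_0 => False_rect _ (notF (ltn_ord i)))).
Qed.

(** The language has no negation, so closed terms only reach nonnegative integers. *)
Lemma tdefZ_const X (k : int) : 0 <= k ->
  tdefinable (fun _ : X -> Z => k : Z).
Proof.
case: k => // k _; elim: k => [|k IH]; first exact: tdefZ_0.
by apply: tdef_ext (tdefZ_add (tdefZ_1 X) IH) => e; rewrite -PoszD.
Qed.

End IntegerArithmetic.

Ltac tdef_atom ::= first
  [ exact: tdefZ_0 | exact: tdefZ_1
  | apply: tdefZ_add; tdef | apply: tdefZ_mul; tdef ].

Section IntegerPairing.
Local Open Scope ring_scope.
Local Notation Z := (ring_structure int).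

Definition divides (a b : int) : Prop := exists c, b = c * a.

Lemma dividesP a b : divides a b <-> (a %| b)%Z.
Proof. by split=> [[c ->]|/dvdzP[c ->]]; [exact: dvdz_mull|exists c]. Qed.

Lemma def_divides X (f g : (X -> Z) -> Z) :
  tdefinable f -> tdefinable g -> definable (fun e => divides (f e) (g e)).
Proof. by move=> tf tg; rewrite /divides; defn. Qed.

(** The polynomial [2x^2 + x] is a term and maps the integers injectively to nonnegative ones: a
    difference of two values is [x - y] times an odd number. *)
Definition fold_sign (x : int) : int := x * x + x * x + x.

Lemma fold_sign_ge0 x : 0 <= fold_sign x.
Proof. rewrite /fold_sign; nia. Qed.

Lemma fold_sign_inj : injective fold_sign.
Proof.
rewrite /fold_sign => x y H.
have /eqP : (x - y) * ((x + y) + (x + y) + 1) = 0.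
  by transitivity ((x * x + x * x + x) - (y * y + y * y + y)); [ring|rewrite H subrr].
by rewrite mulf_eq0 => /orP[]/eqP; lia.
Qed.

(** A pairing without the division in Cantor's, hence a term. With [S] the sum of the two folded
    arguments, the value lies between [S^2] and [S^2 + S], below the next square, so it determines
    [S]. *)
Definition pair_int (x y : int) : int :=
  (fold_sign x + fold_sign y) * (fold_sign x + fold_sign y) + fold_sign x.

Lemma pair_int_ge0 x y : 0 <= pair_int x y.
Proof. by rewrite /pair_int addr_ge0 ?fold_sign_ge0 // -expr2 sqr_ge0. Qed.

Lemma pair_int_inj x y x' y' : pair_int x y = pair_int x' y' -> x = x' /\ y = y'.
Proof.
rewrite /pair_int => H.
have := fold_sign_ge0 x; have := fold_sign_ge0 x'.
have := fold_sign_ge0 y; have := fold_sign_ge0 y'.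
move: H (@fold_sign_inj x x') (@fold_sign_inj y y').
move: (fold_sign x) (fold_sign y) (fold_sign x') (fold_sign y') => X Y X' Y' H.
move=> Hx Hy y'0 y0 x'0 x0.
have E : X + Y = X' + Y'.
  case: (ltgtP (X + Y) (X' + Y')) => // lt_S.
  - have : (X + Y + 1) * (X + Y + 1) <= (X' + Y') * (X' + Y') by apply: ler_pM; lia.
    lia.
  - have : (X' + Y' + 1) * (X' + Y' + 1) <= (X + Y) * (X + Y) by apply: ler_pM; lia.
    lia.
have EX : X = X' by move: H; rewrite E; lia.
by split; [exact: Hx|apply: Hy; lia].
Qed.

Lemma tdef_pair_int X (f g : (X -> Z) -> Z) :
  tdefinable f -> tdefinable g -> tdefinable (fun e => pair_int (f e) (g e) : Z).
Proof. by move=> tf tg; rewrite /pair_int /fold_sign; tdef. Qed.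

Fixpoint tuple_int n : ('I_n -> int) -> int :=
  match n with
  | 0 => fun=> 0
  | _.+1 => fun a => pair_int (a ord0) (tuple_int (fun i => a (lift ord0 i)))
  end.

Lemma tuple_int_inj n : injective (@tuple_int n).
Proof.
elim: n => [|n IH] a b /= H.
  by apply: functional_extensionality => -[].
have [H0 /IH H1] := pair_int_inj H.
rewrite -(tuple_consK a) -(tuple_consK b) H0.
by apply: functional_extensionality => i; case: (unlift ord0 i) => // j;
  exact: (congr1 (fun f => f j) H1).
Qed.

Lemma tdef_tuple_int n X (a : 'I_n -> (X -> Z) -> Z) :
  (forall i, tdefinable (a i)) ->
  tdefinable (fun e => tuple_int (fun i => a i e) : Z).
Proof.
elim: n a => [|n IH] a Ha /=; first exact: tdefZ_0.
by apply: tdef_pair_int => //; apply: (IH (fun i => a (lift ord0 i))).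
Qed.

End IntegerPairing.

Ltac tdef_atom ::= first
  [ exact: tdefZ_0 | exact: tdefZ_1
  | apply: tdefZ_add; tdef | apply: tdefZ_mul; tdef
  | apply: tdef_pair_int; tdef | apply: tdef_tuple_int; intro; tdef ].

Ltac def_atom ::= apply: def_divides.

(** * Finite sets of integers coded by divisibility *)

Section FiniteSets.
Local Open Scope ring_scope.
Local Notation Z := (ring_structure int).

Definition odd_int (x : int) : int := x + x + 1.

(** The clause [divides (odd_int x) k] bounds [x], since [k != 0]; this avoids the
    order, which is not yet known to be definable. *)
Definition member (y x : int) : Prop :=
  exists u w k, y = pair_int u (pair_int w k) /\ k <> 0 /\
    divides (odd_int x) k /\ divides (1 + odd_int x * w) u.

Lemma def_member X (f g : (X -> Z) -> Z) :
  tdefinable f -> tdefinable g -> definable (fun e => member (f e) (g e)).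
Proof.
move=> tf tg; rewrite /member /odd_int; defn.
Qed.

Lemma member_finite y : exists s : seq int, forall x, member y x -> x \in s.
Proof.
have [[x0 [u [w [k [Ey [k0 _]]]]]]|N] :=
  excluded_middle_informative (exists x, member y x); last first.
  by exists [::] => x mx; case: N; exists x.
(* As [2x + 1] divides the nonzero [k], its absolute value, and hence that of [x], is at most that
   of [k]. *)
exists ([seq i%:Z | i <- iota 0 `|k|.+1] ++ [seq - i%:Z | i <- iota 0 `|k|.+1]).
move=> x [u' [w' [k' [Ey' [_ [/dividesP dk _]]]]]].
have [_ /pair_int_inj[_ Ek]] := pair_int_inj (etrans (esym Ey) Ey').
subst k'.
have le_x : (`|odd_int x| <= `|k|)%N.
  by apply: dvdn_leq; rewrite ?absz_gt0 //; apply/eqP.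
rewrite mem_cat; apply/orP.
have [x_ge0|x_lt0] := leP 0 x; [left|right]; apply/mapP; exists `|x|%N;
  rewrite ?mem_iota; move: le_x; rewrite /odd_int; lia.
Qed.

Lemma odd_int_neq0 x : odd_int x != 0.
Proof. by rewrite /odd_int; lia. Qed.

Lemma fact_dvdz (M : nat) (d : int) : d != 0 -> (`|d| <= M)%N -> (d %| (M`!)%:Z)%Z.
Proof.
move=> d0 dM; rewrite /dvdz /=; apply: dvdn_fact.
by rewrite absz_gt0 d0.
Qed.

(** As for the moduli of Gödel's beta function: the two numbers differ by a multiple of [w] whose
    cofactor divides [w], and [1 + o w] is coprime to [w]. *)
Lemma coprime_succ_mul (w o o' : int) :
  (o' - o %| w)%Z -> coprimez (1 + o * w) (1 + o' * w).
Proof.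
move=> dw.
have cw : coprimez (1 + o * w) w.
  by apply/coprimezP; exists (1, - o) => /=; ring.
have co : coprimez (1 + o * w) ((o' - o) * w).
  rewrite coprimezMr cw andbT; exact: coprimez_dvdr dw cw.
have -> : 1 + o' * w = (1 + o * w) * 1 + (o' - o) * w by ring.
by rewrite /coprimez mulr1 gcdzDl.
Qed.

Lemma member_surj (s : seq int) : exists y, 0 <= y /\ forall x, member y x <-> x \in s.
Proof.
pose k := \prod_(x <- s) odd_int x.
have k0 : k != 0.
  by rewrite prodf_seq_neq0; apply/allP => x _; rewrite odd_int_neq0.
(* Two odd numbers dividing [k] differ by at most [2|k|], so their difference divides [w = M!] and
   the moduli are pairwise coprime. The summand 3 gives [w >= 3], so that no modulus is a unit. *)
pose M := (2 * `|k| + 3)%N.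
pose w : int := (M`!)%:Z.
pose u := \prod_(x <- s) (1 + odd_int x * w).
exists (pair_int u (pair_int w k)); split; first exact: pair_int_ge0.
have small x : (odd_int x %| k)%Z -> (`|odd_int x| <= `|k|)%N.
  by move=> dk; apply: dvdn_leq; rewrite ?absz_gt0.
have in_k x : x \in s -> (odd_int x %| k)%Z.
  by move=> xs; rewrite /k (big_rem x) //=; apply: dvdz_mulr.
move=> x; split=> [[u' [w' [k' [E [_ [/dividesP dk /dividesP du]]]]]]|xs]; last first.
  exists u, w, k; split=> //; split; first exact/eqP.
  split; first exact/dividesP/in_k.
  by apply/dividesP; rewrite /u (big_rem x) //=; apply: dvdz_mulr.
have [Eu /pair_int_inj[Ew Ek]] := pair_int_inj E; subst u' w' k'.
apply/negPn/negP => xs.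
(* The modulus of a non-element is coprime to [u]; dividing [u] as well, it would be a unit. *)
have cu : coprimez (1 + odd_int x * w) u.
  rewrite /u; have : {subset s <= s} by [].
  elim: {1 3}s => [_|z s' IH sub]; first by rewrite big_nil /coprimez gcdz1.
  rewrite big_cons coprimezMr IH ?andbT; last by move=> t ts; apply: sub; rewrite inE ts orbT.
  have zs : z \in s by apply: sub; rewrite inE eqxx.
  apply: coprime_succ_mul; apply: fact_dvdz.
    by apply: contraNneq xs => E0; have -> : x = z by move: E0; rewrite /odd_int; lia.
  have := small _ dk; have := small _ (in_k _ zs); rewrite /M; lia.
have : absz (1 + odd_int x * w) = 1%N.
  apply/eqP; rewrite -dvdn1.
  by have := du; rewrite -[X in (_ %| X)%Z]mul1r Gauss_dvdzl.
have wM : (3 <= M`!)%N.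
  apply: (@leq_trans M); first by rewrite /M; lia.
  by apply: dvdn_leq; rewrite ?fact_gt0 ?dvdn_fact // /M; lia.
have := odd_int_neq0 x; rewrite /w; nia.
Qed.

(** A finite set containing [0] and closed under successor except at [x] exists exactly
    when [0 <= x]. *)
Definition nonneg (x : int) : Prop :=
  exists y, member y 0 /\ forall z, member y z -> z <> x -> member y (z + 1).

Lemma nonnegP x : nonneg x <-> 0 <= x.
Proof.
split=> [[y [y0 yS]]|x_ge0].
  (* For negative [x] the closure never stops, and the finite set would contain every natural
     number. *)
  have [s sP] := member_finite y; rewrite leNgt; apply/negP => x_lt0.
  have all_in (i : nat) : member y i%:Z.
    elim: i => // i IH; have -> : i.+1%:Z = i%:Z + 1 by lia.
    by apply: yS => //; lia.
  have := uniq_leq_size (s1 := map Posz (iota 0 (size s).+1)) (s2 := s).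
  rewrite map_inj_uniq ?iota_uniq ?size_map ?size_iota ?ltnn //; last by move=> i j [].
  by move=> H; suff : false by []; apply: H => // z /mapP[i _ ->]; apply: sP.
have [y [_ yP]] := member_surj (map Posz (iota 0 `|x|.+1)).
exists y; split; first by apply/yP/mapP; exists 0%N.
move=> z /yP/mapP[i]; rewrite mem_iota => ilt -> ix; apply/yP/mapP.
by exists i.+1; rewrite ?mem_iota; lia.
Qed.

Lemma def_nonneg X (f : (X -> Z) -> Z) :
  tdefinable f -> definable (fun e => nonneg (f e)).
Proof. by move=> tf; rewrite /nonneg; repeat first [apply: def_member; tdef | def_step]. Qed.

End FiniteSets.

Ltac def_atom ::= first [apply: def_divides | apply: def_member | apply: def_nonneg].

(** * Finitely supported functions and their least codes *)

Section Coefficients.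
Local Open Scope ring_scope.
Local Notation Z := (ring_structure int).
Context (n m : nat).
Implicit Types (y : int) (a : 'I_n -> int) (v : 'I_m -> int).

(** The finite set coded by [y] is read as the graph of a function, through the codes of its
    pairs. *)
Definition value_at y a v : Prop :=
  member y (pair_int (tuple_int a) (tuple_int v)) /\
  forall v', member y (pair_int (tuple_int a) (tuple_int v')) -> forall j, v' j = v j.

(** Every integer codes a function: a point without a unique value is sent to [0]. *)
Definition coef y a v : Prop :=
  value_at y a v \/ (forall j, v j = 0) /\ ~ exists v', value_at y a v'.

Lemma def_coef X (y : (X -> Z) -> Z) (a : 'I_n -> (X -> Z) -> Z)
    (v : 'I_m -> (X -> Z) -> Z) :
  tdefinable y -> (forall i, tdefinable (a i)) -> (forall j, tdefinable (v j)) ->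
  definable (fun e => coef (y e) (fun i => a i e) (fun j => v j e)).
Proof. by move=> ty ta tv; rewrite /coef /value_at; defn. Qed.

Lemma coef_unique y a v v' : coef y a v -> coef y a v' -> v = v'.
Proof.
move=> H H'; apply: functional_extensionality => j.
case: H H' => [[mv uv]|[v0 nv]] [[mv' uv']|[v0' nv']].
- exact: uv'.
- by case: nv'; exists v.
- by case: nv; exists v'.
- by rewrite v0 v0'.
Qed.

Lemma coef_total y a : exists v, coef y a v.
Proof.
have [[v Hv]|N] := excluded_middle_informative (exists v, value_at y a v).
  by exists v; left.
by exists (fun=> 0); right.
Qed.

(** A nonzero value is never the default one, so its pair belongs to the finite set coded by [y]. *)
Lemma coef_finite y :
  exists s : seq ('I_n -> int), forall a v, coef y a v ->
    (exists j, v j <> 0) -> List.In a s.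
Proof.
have [s sP] := member_finite y.
pose pre x a := exists v, x = pair_int (tuple_int a) (tuple_int v).
pose g x := if excluded_middle_informative (exists a, pre x a) is left H
  then [:: proj1_sig (constructive_indefinite_description _ H)] else [::].
exists (flatten (map g s)) => a v [[mv _]|[v0 _]] [j vj]; last by rewrite v0 in vj.
have := sP _ mv; set x := pair_int _ _ => xs.
have gx : g x = [:: a].
  rewrite /g; case: excluded_middle_informative => [H|[]]; last by exists a, v.
  case: constructive_indefinite_description => /= a' [v' /pair_int_inj[E _]].
  by rewrite (tuple_int_inj E).
elim: s xs {sP} => //= z s IH; rewrite inE => /orP[/eqP<-|/IH H].
  by rewrite gx; left.
by apply/List.in_or_app; right.
Qed.

(** Code the graph of [f] over [s]; elsewhere the default value 0 is the right one. *)
Lemma coef_surj (s : seq ('I_n -> int)) (f : ('I_n -> int) -> 'I_m -> int) :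
  (forall a j, f a j <> 0 -> List.In a s) ->
  exists y, 0 <= y /\ forall a, coef y a (f a).
Proof.
move=> fs.
have [y [y0 yP]] := member_surj [seq pair_int (tuple_int a) (tuple_int (f a)) | a <- s].
have mem_map a v : member y (pair_int (tuple_int a) (tuple_int v)) <->
    v = f a /\ List.In a s.
  rewrite yP; elim: s {fs y0 yP} => [|b s IH]; first by split=> // -[].
  rewrite inE /=; split=> [/orP[/eqP/pair_int_inj[/tuple_int_inj <- /tuple_int_inj]|/IH[]]|].
  - by split=> //; left.
  - by split=> //; right.
  - move=> [Ev [Eb|ins]]; first by rewrite Ev Eb eqxx.
    by apply/orP; right; apply/IH.
exists y; split=> // a.
have [ins|nins] := excluded_middle_informative (List.In a s).
  left; split; first exact/mem_map.
  by move=> v' /mem_map[->].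
right; split=> [j|[v' [/mem_map[_]]] //].
by apply/eqP/negPn/negP => /eqP /fs.
Qed.

Definition same_coef y y' : Prop := forall a v, coef y a v <-> coef y' a v.

(** Only nonnegative codes compete, so that a least one exists; by [coef_surj] every finitely
    supported function has such a code. *)
Definition canonical y : Prop :=
  nonneg y /\ forall y', nonneg y' -> same_coef y y' -> exists d, nonneg d /\ y' = y + d.

Lemma canonical_inj y y' : canonical y -> canonical y' -> same_coef y y' -> y = y'.
Proof.
move=> [y0 ymin] [y'0 y'min] E.
have [d [/nonnegP d0 Ed]] := ymin _ y'0 E.
have [d' [/nonnegP d'0 Ed']] : exists d, nonneg d /\ y = y' + d.
  by apply: y'min => // a v; rewrite E.
lia.
Qed.

Lemma canonical_exists y : 0 <= y -> exists2 y', canonical y' & same_coef y y'.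
Proof.
move=> y0; pose P i := excluded_middle_informative (same_coef y i%:Z) : bool.
have PP i : P i <-> same_coef y i%:Z by rewrite /P; case: excluded_middle_informative.
have exP : exists i, P i by exists `|y|%N; apply/PP; rewrite gez0_abs.
case: (ex_minnP exP) => i /PP Ei imin.
exists i%:Z => //; split; first exact/nonnegP.
move=> y' /nonnegP y'0 E'; exists (y' - i%:Z); split; last by ring.
apply/nonnegP; rewrite subr_ge0 -(gez0_abs y'0) lez_nat; apply: imin; apply/PP.
by move=> a v; rewrite Ei E' gez0_abs.
Qed.

End Coefficients.

Lemma def_same_coef n m X (f g : (X -> ring_structure int) -> ring_structure int) :
  tdefinable f -> tdefinable g -> definable (fun e => same_coef n m (f e) (g e)).
Proof.
by move=> tf tg; rewrite /same_coef; repeat first [apply: def_coef | def_step].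
Qed.

Lemma def_canonical n m X (f : (X -> ring_structure int) -> ring_structure int) :
  tdefinable f -> definable (fun e => canonical n m (f e)).
Proof.
by move=> tf; rewrite /canonical; repeat first [apply: def_same_coef | def_step].
Qed.

Ltac def_atom ::= first [apply: def_divides | apply: def_member | apply: def_nonneg
  | apply: def_coef | apply: def_canonical].

(** * The wreath product inside the integers *)

Section Bases.
Local Open Scope ring_scope.

Definition comb (V : zmodType) d (b : 'I_d -> V) (k : 'I_d -> int) : V :=
  \sum_(i < d) b i *~ k i.

Record basis (V : zmodType) d := Basis {
  bvec :> 'I_d -> V;
  crd : V -> 'I_d -> int;
  crdK : forall x, comb bvec (crd x) = x;
  combK : forall k, crd (comb bvec k) = k }.

Lemma free_basis (V : zmodType) d : free_abelian_of_rank V d -> exists b : basis V d, True.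
Proof.
case=> b [g bK gK].
unshelve eexists (@Basis V d b (fun x => g x) _ _) => //.
move=> k; apply: functional_extensionality => i.
  have -> : comb b k = \sum_(j < d) b j *~ [ffun j => k j] j.
    by apply: eq_bigr => j _; rewrite ffunE.
  by rewrite bK ffunE.
Qed.

Context (V : zmodType) (d : nat) (b : basis V d).
Implicit Types (x y : V) (i j : 'I_d).

Lemma crd_inj x y : crd b x = crd b y -> x = y.
Proof. by move=> E; rewrite -(crdK b x) E crdK. Qed.

Lemma crdD x y i : crd b (x + y) i = crd b x i + crd b y i.
Proof.
rewrite -{1}(crdK b x) -{1}(crdK b y) /comb -big_split /=.
under eq_bigr => j _ do rewrite -mulrzDr.
by rewrite -[\sum_j _]/(comb b (fun j => crd b x j + crd b y j)) combK.
Qed.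

Lemma crd0 i : crd b 0 i = 0.
Proof. by have := crdD 0 0 i; rewrite addr0; lia. Qed.

Lemma crdN x i : crd b (- x) i = - crd b x i.
Proof. by have := crdD x (- x) i; rewrite subrr crd0; lia. Qed.

Lemma crdB x y i : crd b (x - y) i = crd b x i - crd b y i.
Proof. by rewrite crdD crdN. Qed.

Lemma crdMz x (k : int) i : crd b (x *~ k) i = crd b x i * k.
Proof.
have crdMn (k' : nat) : crd b (x *+ k') i = crd b x i * k'%:Z.
  by elim: k' => [|k' IH]; rewrite ?mulr0n ?crd0 ?mulr0 // mulrS crdD IH; lia.
case: k => k'; first by rewrite -pmulrn crdMn.
by rewrite NegzE mulrNz -pmulrn crdN crdMn; lia.
Qed.

Lemma crd_basis i j : crd b (b i) j = (i == j)%:Z.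
Proof.
have -> : b i = comb b (fun k => (i == k)%:Z).
  rewrite /comb (bigD1 i) //= eqxx mulr1z big1 ?addr0 // => k ik.
  by rewrite eq_sym (negbTE ik) mulr0z.
by rewrite combK.
Qed.

Lemma basis_vec_neq0 i : b i <> 0.
Proof. by move=> /(congr1 (fun a => crd b a i)); rewrite crd_basis eqxx crd0. Qed.

Lemma combD (k k' : 'I_d -> int) : comb b k + comb b k' = comb b (fun i => k i + k' i).
Proof.
by apply: crd_inj; apply: functional_extensionality => i; rewrite crdD !combK.
Qed.

End Bases.

Section Decoding.
Local Open Scope ring_scope.
Context (A B : zmodType) (n m : nat) (bA : basis A n) (bB : basis B m).

(** [coef] is total, and its nonzero points lie in a finite list, which bounds the support. *)
Lemma decode_exists (y : int) :
  exists f : {malg B[A]}, forall a, coef y (crd bA a) (crd bB f@_a).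
Proof.
have [s sP] := coef_finite n m y.
pose P (k : 'I_n -> int) := constructive_indefinite_description _ (coef_total m y k).
pose g a := comb bB (proj1_sig (P (crd bA a))).
have gP a : coef y (crd bA a) (crd bB (g a)).
  by rewrite combK; exact: (proj2_sig (P (crd bA a))).
exists [malg a in [fset x in map (comb bA) s]%fset => g a] => a.
rewrite mcoeffE; case: ifPn => [_|]; first exact: gP.
rewrite in_fset /= => ns; have := gP a.
suff -> : g a = 0 by [].
apply: (crd_inj (b := bB)); apply: functional_extensionality => j; rewrite crd0.
apply/eqP/negPn/negP => /eqP gj; case/negP: ns; rewrite -(crdK bA a).
have := sP _ _ (gP a) (ex_intro _ j gj).
elim: s {sP} => //= k s IH [->|/IH H]; rewrite inE ?eqxx //.
by rewrite H orbT.
Qed.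

Definition decode (y : int) : {malg B[A]} :=
  proj1_sig (constructive_indefinite_description _ (decode_exists y)).

Lemma decodeP y a v : coef y (crd bA a) v <-> v = crd bB (decode y)@_a.
Proof.
have H := proj2_sig (constructive_indefinite_description _ (decode_exists y)).
split=> [Hv|->]; last exact: H.
exact: coef_unique Hv (H a).
Qed.

Lemma same_coef_decode y y' : same_coef n m y y' <-> decode y = decode y'.
Proof.
split=> [E|E k v].
  apply/malgP => a; apply: (crd_inj (b := bB)).
  by apply/decodeP/E/decodeP.
by rewrite -(combK bA k) !decodeP E.
Qed.

Lemma decode_surj f : exists2 y, canonical n m y & decode y = f.
Proof.
pose s := [seq crd bA a | a <- msupp f].
have [|y [y0 yP]] := @coef_surj n m s (fun k => crd bB f@_(comb bA k)).
  move=> k j fj; rewrite -(combK bA k); have : comb bA k \in enum_fset (msupp f).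
    change (comb bA k \in msupp f); rewrite -mcoeff_neq0.
    by apply: contra_notN fj => /eqP E; rewrite E crd0.
  rewrite /s; elim: (enum_fset (msupp f)) => [|a l IH]; rewrite inE //=.
  by move=> /orP[/eqP->|/IH H]; [left|right].
have [y' cy' /same_coef_decode E] := canonical_exists n m y0.
exists y' => //; rewrite -E; apply/malgP => a; apply: (crd_inj (b := bB)).
by apply/esym/decodeP; rewrite -{2}(crdK bA a).
Qed.

Lemma decode_inj y y' : canonical n m y -> canonical n m y' -> decode y = decode y' -> y = y'.
Proof. by move=> cy cy' E; apply: (canonical_inj cy cy'); apply/same_coef_decode. Qed.

End Decoding.

Section FormulaOf.
Context {L : language} (M : structure L) (X : Type) (R : (X -> M) -> Prop).

Definition formula_of (H : definable R) : formula L X :=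
  proj1_sig (constructive_indefinite_description _ H).

Lemma sat_formula_of (H : definable R) e : sat e (formula_of H) <-> R e.
Proof. exact: (proj2_sig (constructive_indefinite_description _ H)). Qed.

End FormulaOf.

Section WreathCode.
Local Open Scope ring_scope.
Local Notation Z := (ring_structure int).
Context (n m : nat).
Implicit Types x y z : 'I_n.+1 -> int.

(** Entry [ord0] of a tuple codes the base component, the other entries are the coordinates of the
    [A]-component. The translated point [a'] is given by an addition because the language has no
    subtraction. *)
Definition code_mul x y z : Prop :=
  (forall i : 'I_n, z (lift ord0 i) = x (lift ord0 i) + y (lift ord0 i)) /\
  forall a a' : 'I_n -> int, (forall i, a i = x (lift ord0 i) + a' i) ->
  forall u v w : 'I_m -> int,
    coef (x ord0) a u -> coef (y ord0) a' v -> coef (z ord0) a w ->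
    forall j, w j = u j + v j.

Definition code_inv x z : Prop :=
  (forall i : 'I_n, x (lift ord0 i) + z (lift ord0 i) = 0) /\
  forall a a' : 'I_n -> int, (forall i, a' i = x (lift ord0 i) + a i) ->
  forall u w : 'I_m -> int, coef (x ord0) a' u -> coef (z ord0) a w ->
    forall j, u j + w j = 0.

Definition code_one z : Prop :=
  (forall i : 'I_n, z (lift ord0 i) = 0) /\
  forall (a : 'I_n -> int) (w : 'I_m -> int), coef (z ord0) a w -> forall j, w j = 0.

Definition code_fun (f : group_symbol) :
    ('I_(group_arity f) -> 'I_n.+1 -> int) -> ('I_n.+1 -> int) -> Prop :=
  match f with
  | GMul => fun xs z => code_mul (xs ord0) (xs ord_max) z
  | GInv => fun xs z => code_inv (xs ord0) z
  | GOne => fun _ z => code_one z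
  end.

Lemma def_code_U :
  definable (fun e : 'I_n.+1 + 'I_0 -> Z => canonical n m (e (inl ord0))).
Proof. by defn. Qed.

Lemma def_code_E :
  definable (fun e : ('I_n.+1 + 'I_n.+1) + 'I_0 -> Z =>
    forall i, e (inl (inl i)) = e (inl (inr i))).
Proof. by defn. Qed.

Lemma def_code_F (f : group_symbol) :
  definable (fun e : ('I_(group_arity f) * 'I_n.+1 + 'I_n.+1) + 'I_0 -> Z =>
    code_fun (fun k i => e (inl (inl (k, i)))) (fun i => e (inl (inr i)))).
Proof.
by case: f; rewrite /code_fun /code_mul /code_inv /code_one; defn.
Qed.

Definition wreath_code : code group_language ring_language :=
  @Code group_language ring_language n.+1 0 (formula_of def_code_U)
    (formula_of def_code_E) (fun f => formula_of (def_code_F f))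
    (fun r : void => match r with end).

Context (A B : zmodType) (bA : basis A n) (bB : basis B m).
Context (p : 'I_(cpar wreath_code) -> Z).

Definition decode_wreath (y : 'I_n.+1 -> int) : wreath B A :=
  Wreath (decode bA bB (y ord0)) (comb bA (fun i => y (lift ord0 i))).

Lemma wreath_code_U (y : 'I_n.+1 -> Z) :
  sat (sumenv y p) (cU wreath_code) <-> canonical n m (y ord0).
Proof. exact: sat_formula_of. Qed.

Lemma wreath_code_E (x y : dom p) : dom_eq x y <-> sval x =1 sval y.
Proof. exact: sat_formula_of. Qed.

Lemma decode_wreath_inj x y : canonical n m (x ord0) -> canonical n m (y ord0) ->
  decode_wreath x = decode_wreath y -> x = y.
Proof.
move=> cx cy [/(decode_inj cx cy) E0 Et].
rewrite -(tuple_consK x) -(tuple_consK y) E0.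
apply: functional_extensionality => i; case: (unlift ord0 i) => // j.
by have := congr1 (fun a => crd bA a j) Et; rewrite !combK.
Qed.

Lemma decode_wreath_surj (g : wreath B A) :
  exists2 y, canonical n m (y ord0) & decode_wreath y = g.
Proof.
case: g => f a; have [c cc Ec] := decode_surj bA bB f.
exists (fun i => if unlift ord0 i is Some j then crd bA a j else c).
  by rewrite unlift_none.
rewrite /decode_wreath unlift_none Ec; congr Wreath.
rewrite -[RHS](crdK bA a); congr comb.
by apply: functional_extensionality => j; rewrite liftK.
Qed.

Lemma code_mulP x y z :
  code_mul x y z <-> wr_mul (decode_wreath x) (decode_wreath y) = decode_wreath z.
Proof.
rewrite /wr_mul /decode_wreath /=; split=> [[Ht Hb]|[Hb Ht]].
  congr Wreath; last first.
    by rewrite combD; congr comb; apply: functional_extensionality => i.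
  apply/malgP => a; rewrite mcoeffD shiftE; set s := comb bA _.
  apply: (crd_inj (b := bB)); apply: functional_extensionality => j; rewrite crdD.
  apply/esym; apply: (Hb (crd bA a) (crd bA (a - s))); try exact/decodeP.
  by move=> i; rewrite crdB combK; ring.
split=> [i|a a' Ea u v w].
  have := congr1 (fun a => crd bA a i) Ht.
  by rewrite /= crdD !combK => <-.
rewrite -(combK bA a) -(combK bA a').
move=> /(decodeP bA bB) -> /(decodeP bA bB) -> /(decodeP bA bB) -> j.
rewrite -Hb mcoeffD shiftE crdD; congr (_ + crd bB _@__ j).
apply: (crd_inj (b := bA)); apply: functional_extensionality => i.
by rewrite crdB !combK Ea; ring.
Qed.

Lemma code_invP x z :
  code_inv x z <-> wr_inv (decode_wreath x) = decode_wreath z.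
Proof.
rewrite /wr_inv /decode_wreath /=; split=> [[Ht Hb]|[Hb Ht]].
  congr Wreath; last first.
    apply: (crd_inj (b := bA)); apply: functional_extensionality => i.
    by rewrite crdN !combK; have := Ht i; lia.
  apply/malgP => a; rewrite mcoeffN shiftE opprK; set s := comb bA _.
  apply: (crd_inj (b := bB)); apply: functional_extensionality => j; rewrite crdN.
  suff : crd bB (decode bA bB (x ord0))@_(a + s) j +
    crd bB (decode bA bB (z ord0))@_a j = 0 by lia.
  apply: (Hb (crd bA a) (crd bA (a + s))); try exact/decodeP.
  by move=> i; rewrite crdD combK; ring.
split=> [i|a a' Ea u w].
  have := congr1 (fun a => crd bA a i) Ht.
  by rewrite /= crdN !combK; lia.
rewrite -(combK bA a) -(combK bA a') => /(decodeP bA bB) -> /(decodeP bA bB) -> j.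
rewrite -Hb mcoeffN shiftE crdN opprK.
set c := (X in _ - crd bB _@_X j); suff -> : c = comb bA a' by rewrite subrr.
apply: (crd_inj (b := bA)); apply: functional_extensionality => i.
by rewrite crdD !combK Ea; ring.
Qed.

Lemma code_oneP z : code_one z <-> wr_one B A = decode_wreath z.
Proof.
rewrite /wr_one /decode_wreath; split=> [[Ht Hb]|[Hb Ht]].
  congr Wreath.
    apply/malgP => a; apply: (crd_inj (b := bB)); apply: functional_extensionality => j.
    by rewrite mcoeff0 crd0; apply/esym; apply: (Hb (crd bA a)); apply/decodeP.
  apply: (crd_inj (b := bA)); apply: functional_extensionality => i.
  by rewrite crd0 combK Ht.
split=> [i|a w].
  by have := congr1 (fun a => crd bA a i) Ht; rewrite /= crd0 combK.
by rewrite -(combK bA a) => /(decodeP bA bB) -> j; rewrite -Hb mcoeff0 crd0.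
Qed.

Lemma wreath_code_coordinate :
  coordinate_map (A := group_structure (wreath B A)) (fun y : dom p => decode_wreath (sval y)).
Proof.
split.
- move=> g; have [y cy <-] := decode_wreath_surj g.
  have Uy : sat (sumenv (y : 'I_n.+1 -> Z) p) (cU wreath_code) by apply/wreath_code_U.
  by exists (in_dom (G := wreath_code) Uy).
- move=> x y; rewrite wreath_code_E; split=> [E|E i].
    by congr decode_wreath; apply: functional_extensionality.
  rewrite (decode_wreath_inj _ _ E) //; first exact/wreath_code_U/(svalP x).
  exact/wreath_code_U/(svalP y).
- move=> f xs y; rewrite /dom_fun sat_formula_of.
  by case: f xs => xs; [exact: code_mulP|exact: code_invP|exact: code_oneP].
- by case.
Qed.

End WreathCode.

(** * The base group as a module over the group ring *)

Section BaseModule.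
Local Open Scope ring_scope.
Context (A B : zmodType).
Implicit Types (f g h : {malg B[A]}) (a b : A) (k : int).

Lemma shift0 f : shift 0 f = f.
Proof. by apply/malgP => x; rewrite shiftE subr0. Qed.

Lemma shiftA a b f : shift a (shift b f) = shift (a + b) f.
Proof. by apply/malgP => x; rewrite !shiftE opprD addrA. Qed.

Lemma shiftD a f g : shift a (f + g) = shift a f + shift a g.
Proof. by apply/malgP => x; rewrite !(mcoeffD, shiftE). Qed.

Lemma shiftN a f : shift a (- f) = - shift a f.
Proof. by apply/malgP => x; rewrite !(mcoeffN, shiftE). Qed.

(** The action of the group ring element [a - 1]. *)
Definition dshift a f := shift a f - f.

Lemma dshiftD a f g : dshift a (f + g) = dshift a f + dshift a g.
Proof. by rewrite /dshift shiftD opprD addrACA. Qed.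

Lemma dshiftN a f : dshift a (- f) = - dshift a f.
Proof. by rewrite /dshift shiftN opprD. Qed.

Lemma dshiftB a f g : dshift a (f - g) = dshift a f - dshift a g.
Proof. by rewrite dshiftD dshiftN. Qed.

Lemma dshift_add a b f : dshift (a + b) f = dshift a (shift b f) + dshift b f.
Proof. by rewrite /dshift shiftA addrA subrK. Qed.

(** [s] is the geometric sum [(1 + a + ... + a^(k-1)) f], where [A] is written
    multiplicatively. *)
Lemma geometric_sum a k f :
  exists s z, dshift (a *~ k) f = dshift a s /\ s - f *~ k = dshift a z.
Proof.
elim/int_rect: k => [|k [s [z [Es Ez]]]|k [s [z [Es Ez]]]].
- exists 0, 0; rewrite !mulr0z subr0 /dshift shift0 !subrr.
  by split; rewrite (_ : shift a 0 = 0) ?subr0 //; apply/malgP => x;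
    rewrite shiftE !mcoeff0.
(* The sum gains the term [a^k f], which is [f + (a - 1) s]; this accounts for the new witness
   [z + s]. *)
- exists (s + shift (a *~ k) f), (z + s); split.
    rewrite dshiftD -Es -addn1 PoszD mulrzDr mulr1z addrC dshift_add.
    by rewrite addrC.
  rewrite dshiftD -Ez -Es /dshift -addn1 PoszD mulrzDr mulr1z opprD.
  by rewrite addrACA.
- pose c := - k%:Z - 1.
  have Ec : - k.+1%:Z = c by rewrite /c; lia.
  (* For negative exponents, [(a^c - 1) / (a - 1)] is the quotient for [c + 1] minus [a^c]. *)
  exists (s - shift (a *~ c) f), (z - (s - shift (a *~ c) f)); rewrite Ec.
  have Ea : a *~ - k%:Z = a + a *~ c.
    by rewrite -{2}[a]mulr1z -mulrzDr; congr (_ *~ _); rewrite /c; lia.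
  have E1 : dshift (a *~ c) f = dshift a (s - shift (a *~ c) f).
    by rewrite dshiftB -Es Ea dshift_add addrAC subrr add0r.
  split=> //; rewrite dshiftB -E1 -Ez /dshift.
  have -> : f *~ - k%:Z = f *~ c + f.
    by rewrite -{3}[f]mulr1z -mulrzDr; congr (_ *~ _); rewrite /c; lia.
  set F := shift _ _; set H := f *~ c.
  by rewrite opprB opprD -!addrA addKr [- F + _]addrC.
Qed.

End BaseModule.

(** * Linear functionals on the base group *)

Section Functionals.
Local Open Scope ring_scope.
Context (A B : zmodType) (n m : nat) (bA : basis A n) (bB : basis B m).
Implicit Types (f g h : {malg B[A]}) (a b : A) (k : int).

Lemma basis_neq0P a : a <> 0 -> exists i, crd bA a i <> 0.
Proof.
move=> a0; apply: NNPP => H; apply: a0; apply: (crd_inj (b := bA)).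
apply: functional_extensionality => i; rewrite crd0.
by apply: NNPP => ai; apply: H; exists i.
Qed.

Lemma mulrz_inj_basis a k k' : a <> 0 -> a *~ k = a *~ k' -> k = k'.
Proof.
move=> /basis_neq0P[i ai] /(congr1 (fun x => crd bA x i)).
by rewrite !crdMz => /mulfI; apply; apply/eqP.
Qed.

(** A nonempty support invariant under [a] would contain an infinite arithmetic progression, as [A]
    is torsion-free. *)
Lemma shift_fixed a f : a <> 0 -> shift a f = f -> f = 0.
Proof.
move=> a0 af; apply/malgP => x; rewrite mcoeff0; apply/eqP/negPn/negP => fx.
have fk (k : nat) : f@_(x - a *~ k%:Z) = f@_x.
  elim: k => [|k IH]; first by rewrite mulr0z subr0.
  by rewrite -IH -{2}af shiftE -addn1 PoszD mulrzDr mulr1z opprD addrA.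
pose s : seq A := enum_fset (msupp f).
have := uniq_leq_size (s1 := [seq x - a *~ i%:Z | i <- iota 0 (size s).+1]) (s2 := s).
rewrite map_inj_uniq ?iota_uniq ?size_map ?size_iota ?ltnn.
  move=> H; suff : false by []; apply: H => // z /mapP[k _ ->].
  by change (x - a *~ k%:Z \in msupp f); rewrite -mcoeff_neq0 fk.
by move=> k k' /addrI/oppr_inj/(mulrz_inj_basis a0)[].
Qed.

Context (R : comNzRingType).

(** The linear extension of a weight on [A]. Constant weights give the augmentation, coordinates
    give moments, indicators of residue classes and characters serve to separate elements. *)
Definition functional (j : 'I_m) (w : A -> R) f : R :=
  \sum_(a <- msupp f) (crd bB f@_a j)%:~R * w a.

Lemma functional_sup j w f (S : {fset A}) : (msupp f `<=` S)%fset ->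
  functional j w f = \sum_(a <- S) (crd bB f@_a j)%:~R * w a.
Proof.
move=> fS; apply: big_fset_incl => // a _ af.
by rewrite mcoeff_outdom // crd0 mul0r.
Qed.

Lemma functionalD j w f g : functional j w (f + g) = functional j w f + functional j w g.
Proof.
pose S := (msupp f `|` msupp g)%fset.
rewrite !(@functional_sup _ _ _ S) ?fsubsetUl ?fsubsetUr ?msuppD_le //.
rewrite -big_split; apply: eq_bigr => a _ /=.
by rewrite mcoeffD crdD intrD mulrDl.
Qed.

Lemma functional0 j w : functional j w 0 = 0.
Proof. by rewrite /functional msupp0 big_seq_fset0. Qed.

Lemma functionalN j w f : functional j w (- f) = - functional j w f.
Proof. by apply/eqP; rewrite -addr_eq0 -functionalD addNr functional0. Qed.

Lemma functionalB j w f g : functional j w (f - g) = functional j w f - functional j w g.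
Proof. by rewrite functionalD functionalN. Qed.

Lemma functionalMz j w f k : functional j w (f *~ k) = k%:~R * functional j w f.
Proof.
have Mn (i : nat) : functional j w (f *+ i) = i%:R * functional j w f.
  by elim: i => [|i IH]; rewrite ?mulr0n ?functional0 ?mul0r // mulrS functionalD IH
    -[in RHS]addn1 natrD mulrDl mul1r addrC.
case: k => k; first by rewrite -pmulrn Mn.
by rewrite NegzE !mulrNz -!pmulrn functionalN Mn mulNr.
Qed.

Lemma functional_sum j w I (s : seq I) (F : I -> {malg B[A]}) :
  functional j w (\sum_(i <- s) F i) = \sum_(i <- s) functional j w (F i).
Proof. by elim/big_rec2: _ => [|i x y _ <-]; rewrite ?functional0 ?functionalD. Qed.

Lemma functional_shift j w a f :
  functional j w (shift a f) = functional j (fun x => w (a + x)) f.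
Proof.
rewrite (@functional_sup _ _ _ [fset (a + y)%R | y in msupp f]%fset).
  rewrite big_imfset /=; last by move=> x y _ _ /addrI.
  by apply: eq_bigr => x _; rewrite shiftE addrAC subrr add0r.
apply/fsubsetP => x; rewrite -mcoeff_neq0 shiftE mcoeff_neq0 => xf.
by apply/imfsetP; exists (x - a) => //; rewrite addrC subrK.
Qed.

Lemma functional_delta j w x a :
  functional j w << x *g a >>%R = (crd bB x j)%:~R * w a.
Proof.
rewrite (@functional_sup _ _ _ [fset a]%fset) ?msuppU_le //.
by rewrite big_seq_fset1 mcoeffUU.
Qed.

Lemma functionalDw j w w' f :
  functional j (fun x => w x + w' x) f = functional j w f + functional j w' f.
Proof. by rewrite -big_split; apply: eq_bigr => a _; rewrite mulrDr. Qed.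

Lemma functionalZw j c w f :
  functional j (fun x => c * w x) f = c * functional j w f.
Proof. by rewrite mulr_sumr; apply: eq_bigr => a _; rewrite mulrCA. Qed.

Definition augmentation j f : R := functional j (fun=> 1) f.

Lemma augmentation_dshift j a f : augmentation j (dshift a f) = 0.
Proof. by rewrite /augmentation functionalB functional_shift subrr. Qed.

Definition moment j i f : R := functional j (fun a => (crd bA a i)%:~R) f.

(** The moment behaves like a derivative at the trivial character. It extracts information from
    equations between multiples of [a - 1], on which the augmentation vanishes. *)
Lemma moment_dshift j i a f :
  moment j i (dshift a f) = (crd bA a i)%:~R * augmentation j f.
Proof.
rewrite /moment functionalB functional_shift.
have -> : (fun x => (crd bA (a + x) i)%:~R) =
    (fun x => (crd bA a i)%:~R * 1 + (crd bA x i)%:~R) :> (A -> R).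
  by apply: functional_extensionality => x; rewrite crdD intrD mulr1.
by rewrite functionalDw functionalZw addrK.
Qed.

End Functionals.

(** * The integers inside the wreath product *)

Section GroupFormulas.
Local Open Scope group_scope.
Context (G : groupType).
Local Notation M := (group_structure G).
Implicit Types r s t u v w x z : G.

Lemma tdefG_mul X (f g : (X -> M) -> M) :
  tdefinable f -> tdefinable g -> tdefinable (fun e => (f e : G) * (g e : G) : M).
Proof.
move=> [t Ht] [u Hu].
by exists (App (GMul : funsym group_language) (fun i : 'I_2 => if i == ord0 then t else u))
  => e /=; rewrite -Ht -Hu.
Qed.

Lemma tdefG_inv X (f : (X -> M) -> M) :
  tdefinable f -> tdefinable (fun e => (f e : G)^-1 : M).
Proof.
move=> [t Ht].
by exists (App (GInv : funsym group_language) (fun=> t)) => e /=; rewrite -Ht.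
Qed.

Lemma tdefG_1 X : tdefinable (fun _ : X -> M => 1 : M).
Proof.
by exists (App (GOne : funsym group_language) (fun i : 'I_0 => False_rect _ (notF (ltn_ord i)))).
Qed.

(** With this convention the commutator with an element [x] of the base group is [(r - 1) x] in
    additive notation. *)
Definition gcomm r x := r * x * r^-1 * x^-1.

Lemma tdef_gcomm X (f g : (X -> M) -> M) :
  tdefinable f -> tdefinable g -> tdefinable (fun e => gcomm (f e) (g e) : M).
Proof.
by move=> tf tg; rewrite /gcomm; do !first [apply: tdefG_mul | apply: tdefG_inv].
Qed.

End GroupFormulas.

Ltac tdef_atom ::= first
  [ exact: tdefZ_0 | exact: tdefZ_1
  | apply: tdefZ_add; tdef | apply: tdefZ_mul; tdef
  | apply: tdef_pair_int; tdef | apply: tdef_tuple_int; intro; tdef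
  | exact: tdefG_1 | apply: tdefG_mul; tdef | apply: tdefG_inv; tdef
  | apply: tdef_gcomm; tdef ].

Section GroupPredicates.
Local Open Scope group_scope.
Context (G : groupType).
Local Notation M := (group_structure G).
Implicit Types r s t u v w x z : G.

(** If [x] lies over [a] in [A], commuting with its conjugates by [f] in the base group
    means [(1 - a)^2 f = 0]; so this says that [a] is trivial. *)
Definition in_base x : Prop := forall u, x * (u * x * u^-1) = u * x * u^-1 * x.

Definition power_of t r : Prop :=
  r * t = t * r /\
  forall x, in_base x -> exists z, in_base z /\ gcomm r x = gcomm t z.

(** For [r = t^k], [s = t^l], [w = t^e] and [x] in the base group, written additively:
    [(t^e - 1) x = (t^k - 1) u], [(t^l - 1) x = (t - 1) v] and [u = v] modulo [t - 1].
    As [u = (e / k) x] and [v = l x] modulo [t - 1], this means [e = k l]. *)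
Definition exponent_mul t r s w : Prop :=
  forall x, in_base x -> exists u v z, in_base u /\ in_base v /\ in_base z /\
    gcomm w x = gcomm r u /\ gcomm s x = gcomm t v /\ u * v^-1 = gcomm t z.

Lemma def_in_base X (f : (X -> M) -> M) :
  tdefinable f -> definable (fun e => in_base (f e : G)).
Proof. by move=> tf; rewrite /in_base; defn. Qed.

Lemma def_power_of X (f g : (X -> M) -> M) :
  tdefinable f -> tdefinable g -> definable (fun e => power_of (f e : G) (g e : G)).
Proof.
by move=> tf tg; rewrite /power_of; repeat first [apply: def_in_base | def_step].
Qed.

Lemma def_exponent_mul X (f1 f2 f3 f4 : (X -> M) -> M) :
  tdefinable f1 -> tdefinable f2 -> tdefinable f3 -> tdefinable f4 ->
  definable (fun e => exponent_mul (f1 e : G) (f2 e) (f3 e) (f4 e)).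
Proof.
by move=> t1 t2 t3 t4; rewrite /exponent_mul; repeat first [apply: def_in_base | def_step].
Qed.

End GroupPredicates.

Ltac def_atom ::= first [apply: def_divides | apply: def_member | apply: def_nonneg
  | apply: def_coef | apply: def_canonical
  | apply: def_in_base | apply: def_power_of | apply: def_exponent_mul].

Section WreathGroup.
Local Open Scope ring_scope.
Context (A B : zmodType) (n m' : nat) (bA : basis A n) (bB : basis B m'.+1).
Local Notation G := (wreath B A).
Implicit Types (f g h : {malg B[A]}) (a b : A) (k : int) (r s t : G).

Lemma wr_topM r s : wr_top (r * s)%g = wr_top r + wr_top s.
Proof. by []. Qed.

Lemma wr_topV r : wr_top r^-1%g = - wr_top r.
Proof. by []. Qed.

Lemma wr_baseM r s : wr_base (r * s)%g = wr_base r + shift (wr_top r) (wr_base s).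
Proof. by []. Qed.

Lemma wreathP r s : wr_base r = wr_base s -> wr_top r = wr_top s -> r = s.
Proof. by case: r s => f a [g b] /= -> ->. Qed.

Definition in_wr f : G := Wreath f 0.

Lemma in_wr_inj : injective in_wr.
Proof. by move=> f g []. Qed.

Lemma in_wrM f g : (in_wr f * in_wr g)%g = in_wr (f + g).
Proof. by apply: wreathP; rewrite ?wr_baseM ?wr_topM /= ?shift0 ?addr0. Qed.

Lemma in_wrV f : (in_wr f)^-1%g = in_wr (- f).
Proof. by apply: wreathP; rewrite /= ?oppr0 ?shift0. Qed.

Lemma conj_in_wr r f : (r * in_wr f * r^-1)%g = in_wr (shift (wr_top r) f).
Proof.
case: r => g a; apply: wreathP; last by rewrite !wr_topM wr_topV /= addr0 subrr.
rewrite !wr_baseM !wr_topM /= addr0 shiftN shiftA subrr shift0.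
by rewrite addrAC subrr add0r.
Qed.

Lemma gcomm_in_wr r f : gcomm r (in_wr f) = in_wr (dshift (wr_top r) f).
Proof. by rewrite /gcomm conj_in_wr in_wrV in_wrM. Qed.

Lemma in_wr_top r : wr_top r = 0 -> exists f, r = in_wr f.
Proof. by case: r => f a /= ->; exists f. Qed.

Definition unit0 : {malg B[A]} := << bB ord0 *g 0 >>.

Lemma in_baseP r : in_base r <-> wr_top r = 0.
Proof.
split=> [|/in_wr_top[f ->] u]; last by rewrite conj_in_wr !in_wrM addrC.
move=> H; apply: NNPP => a0.
have := congr1 (fun x => crd bB (wr_base x)@_0 ord0) (H (in_wr unit0)).
case: r {H} a0 => f a a0; rewrite [wr_top _]/= in a0.
have [i ai] := basis_neq0P bA a0.
(* The two sides differ by [(1 - a)^2 unit0] up to sign. Its coefficient at 0 does not vanish,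
   because [a] and [2a] are nonzero. *)
have ne k : k <> 0 -> (0 == a *~ k) = false.
  move=> k0; apply/eqP => /(congr1 (fun x => crd bA x i)).
  by rewrite crd0 crdMz => /esym/eqP; rewrite mulf_eq0 => /orP[]/eqP.
rewrite !wr_baseM !wr_topM !wr_topV /=.
rewrite !(mcoeffD, shiftE, mcoeffN, mcoeffU) !(crdD, crdN).
rewrite !(sub0r, add0r, subr0, oppr0, addr0) eqxx.
have -> : (0 == - a - a) = false by rewrite -(ne (- 2)) // mulrNz -mulr2n opprD.
have -> : (0 == - a) = false by rewrite -(ne (- 1)) // mulrNz mulr1z.
rewrite !mulr0n !mulr1n !crd0 crd_basis eqxx /=.
by move: (crd _ _ _) (crd _ _ _) => p q; lia.
Qed.

Lemma in_base_in_wr f : in_base (in_wr f).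
Proof. exact/in_baseP. Qed.

Lemma in_base_ex x : in_base x -> exists f, x = in_wr f.
Proof. by move/in_baseP/in_wr_top. Qed.

Lemma augmentation_unit0 : augmentation bB int ord0 unit0 = 1.
Proof. by rewrite /augmentation functional_delta crd_basis. Qed.

Lemma wr_topX r k : exists2 s : G, (s * r = r * s)%g & wr_top s = wr_top r *~ k.
Proof.
have pos (i : nat) : exists2 s : G, (s * r = r * s)%g & wr_top s = wr_top r *+ i.
  elim: i => [|i [s sr Es]]; first by exists 1%g; rewrite ?mul1g ?mulg1 ?mulr0n.
  exists (r * s)%g; first by rewrite -mulgA sr.
  by rewrite wr_topM Es mulrS.
case: k => i; first exact: pos.
have [s sr Es] := pos i.+1; exists s^-1%g; last by rewrite wr_topV Es NegzE mulrNz.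
by apply: (mulgI s); rewrite mulgA mulgV mul1g !mulgA sr mulgK.
Qed.

(** The bases of [r] and [s] differ by an element fixed by [t], which is 0; elements of the
    centraliser of [t] are thus determined by their [A]-components. *)
Lemma commuting_eq r s t : wr_top t <> 0 -> (r * t = t * r)%g -> (s * t = t * s)%g ->
  wr_top r = wr_top s -> r = s.
Proof.
move=> t0 rt st rs; apply: wreathP => //; apply/eqP; rewrite -subr_eq0; apply/eqP.
apply: (shift_fixed bA t0).
have := congr1 (@wr_base B A) rt; have := congr1 (@wr_base B A) st.
rewrite !wr_baseM rs shiftD shiftN => Es Er.
have -> : shift (wr_top t) (wr_base r) =
    - wr_base t + (wr_base r + shift (wr_top s) (wr_base t)) by rewrite Er addKr.
have -> : shift (wr_top t) (wr_base s) =
    - wr_base t + (wr_base s + shift (wr_top s) (wr_base t)) by rewrite Es addKr.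
by rewrite opprD addrACA subrr add0r opprD addrACA subrr addr0.
Qed.

Lemma power_ofP t r : wr_top t <> 0 ->
  power_of t r <-> (r * t = t * r)%g /\ exists k, wr_top r = wr_top t *~ k.
Proof.
move=> t0; split=> [[rt H]|[rt [k Ek]]]; split=> //.
  have [_ [/in_base_ex[g ->]]] := H _ (in_base_in_wr unit0).
  rewrite !gcomm_in_wr => /in_wr_inj E.
  (* Taking moments of [(r - 1) unit0 = (t - 1) g] in every coordinate of [A] yields the same
     factor, the augmentation of [g]. *)
  exists (augmentation bB int ord0 g); apply: (crd_inj (b := bA)).
  apply: functional_extensionality => i; rewrite crdMz.
  have := congr1 (moment bA bB int ord0 i) E.
  by rewrite !moment_dshift augmentation_unit0 mulr1 !intz.
move=> x /in_base_ex[f ->]; have [s [z [Es _]]] := geometric_sum (wr_top t) k f.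
by exists (in_wr s); split; rewrite ?gcomm_in_wr ?Ek ?Es //; exact: in_base_in_wr.
Qed.

Lemma exponent_mulP t r s w (k l e : int) : wr_top t <> 0 ->
  wr_top r = wr_top t *~ k -> wr_top s = wr_top t *~ l -> wr_top w = wr_top t *~ e ->
  exponent_mul t r s w <-> k * l = e.
Proof.
move=> t0 Er Es Ew; split=> [H|Ee].
  have [_ [_ [_ [/in_base_ex[u ->] [/in_base_ex[v ->] [/in_base_ex[z ->]]]]]]] :=
    H _ (in_base_in_wr unit0).
  rewrite !gcomm_in_wr in_wrV in_wrM => -[/in_wr_inj Eu [/in_wr_inj Ev /in_wr_inj Ez]].
  have [i ti] := basis_neq0P bA t0.
  have Au := congr1 (moment bA bB int ord0 i) Eu.
  have Av := congr1 (moment bA bB int ord0 i) Ev.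
  have := congr1 (augmentation bB int ord0) Ez.
  move: Au Av; rewrite !moment_dshift augmentation_unit0 augmentation_dshift.
  rewrite /augmentation functionalB -!/(augmentation _ _ _ _) !intz !mulr1.
  rewrite Er Es Ew !crdMz -!mulrA => /(mulfI (introN eqP ti)) -> /(mulfI (introN eqP ti)) ->.
  by move=> /eqP; rewrite subr_eq0 => /eqP ->.
move=> x /in_base_ex[f ->].
have [u [z1 [Eu Ez1]]] := geometric_sum (wr_top t *~ k) l f.
have [v [z2 [Ev Ez2]]] := geometric_sum (wr_top t) l f.
(* Both [u] and [v] are congruent to [l f], but [u] only modulo [t^k - 1] so far; [z3] rewrites this
   multiple as one of [t - 1]. *)
have [z3 [_ [Ez3 _]]] := geometric_sum (wr_top t) k z1.
exists (in_wr u), (in_wr v), (in_wr (z3 - z2)).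
split; first exact: in_base_in_wr.
split; first exact: in_base_in_wr.
split; first exact: in_base_in_wr.
split; last split.
- by rewrite !gcomm_in_wr Er Ew -Ee mulrzA Eu.
- by rewrite !gcomm_in_wr Es Ev.
- rewrite in_wrV in_wrM gcomm_in_wr dshiftB -Ez2 -Ez3 -Ez1.
  by rewrite opprB addrA subrK.
Qed.

End WreathGroup.

(** * The copy of the integers formed by the powers of an element *)

Section IntegerCode.
Context (G : groupType) (l : nat) (i0 : 'I_l).
Local Notation M := (group_structure G).

Definition exponent_fun (t : G) (f : ring_symbol) : ('I_(ring_arity f) -> G) -> G -> Prop :=
  match f with
  | RAdd => fun xs z => (xs ord0 * xs ord_max)%g = z
  | RMul => fun xs z => exponent_mul t (xs ord0) (xs ord_max) z
  | RZero => fun _ z => 1%g = z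
  | ROne => fun _ z => t = z
  end.

Lemma def_exponent_U :
  definable (fun e : 'I_1 + 'I_l -> M => power_of (e (inr i0) : G) (e (inl ord0))).
Proof. by defn. Qed.

Lemma def_exponent_E :
  definable (fun e : ('I_1 + 'I_1) + 'I_l -> M => e (inl (inl ord0)) = e (inl (inr ord0))).
Proof. by defn. Qed.

Lemma def_exponent_F (f : ring_symbol) :
  definable (fun e : ('I_(ring_arity f) * 'I_1 + 'I_1) + 'I_l -> M =>
    exponent_fun (e (inr i0)) (fun k => e (inl (inl (k, ord0)))) (e (inl (inr ord0)))).
Proof. by case: f; rewrite /exponent_fun; defn. Qed.

(** The entry at [i0] supplies the element whose powers represent the integers. The tuple has length
    [l] so that it can carry a whole basis, on which the definable isomorphism of the group
    relies. *)
Definition integer_code : code ring_language group_language :=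
  @Code ring_language group_language 1 l (formula_of def_exponent_U)
    (formula_of def_exponent_E) (fun f => formula_of (def_exponent_F f))
    (fun r : void => match r with end).

Context (p : 'I_(cpar integer_code) -> M).

Lemma integer_code_U (y : 'I_1 -> M) :
  sat (sumenv y p) (cU integer_code) <-> power_of (p i0 : G) (y ord0).
Proof. exact: sat_formula_of. Qed.

Lemma integer_code_E (x y : dom p) : dom_eq x y <-> sval x =1 sval y.
Proof.
rewrite /dom_eq sat_formula_of /=; split=> [E i|]; last exact.
by rewrite (ord1 i).
Qed.

End IntegerCode.

Section IntegerCodeWreath.
Local Open Scope ring_scope.
Context (A B : zmodType) (n m' : nat) (bA : basis A n) (bB : basis B m'.+1).
Context (l : nat) (i0 : 'I_l).
Local Notation G := (wreath B A).
Local Notation D := (integer_code G i0).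
Context (p : 'I_(cpar D) -> group_structure G).
Local Notation t := (p i0 : G).

Lemma integer_code_coordinate : wr_top t <> 0 ->
  exists2 nu : dom p -> ring_structure int, coordinate_map nu &
    forall x : dom p, wr_top (sval x ord0 : G) = wr_top t *~ nu x.
Proof.
move=> t0.
have ex (x : dom p) : exists k, wr_top (sval x ord0 : G) = wr_top t *~ k.
  have /integer_code_U := svalP x.
  by rewrite (power_ofP bA bB) // => -[].
pose nu x := proj1_sig (constructive_indefinite_description _ (ex x)).
have nuP x : wr_top (sval x ord0 : G) = wr_top t *~ nu x.
  exact: (proj2_sig (constructive_indefinite_description _ (ex x))).
have comm (x : dom p) : (sval x ord0 * t = t * sval x ord0 :> G)%g.
  by have /integer_code_U[] := svalP x.
(* Equality in the centraliser of [t] is equality of exponents; this settles every operation except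
   multiplication. *)
have nu_eq (r : G) k (y : dom p) : (r * t = t * r)%g -> wr_top r = wr_top t *~ k ->
    r = sval y ord0 <-> k = nu y.
  move=> rt Er; split=> [Ey|Ek].
    by apply: (mulrz_inj_basis bA t0); rewrite -nuP -Ey.
  by apply: (commuting_eq bA t0) => //; rewrite nuP Er Ek.
exists nu => //; split.
- move=> k; have [s st Es] := wr_topX t k.
  have Us : sat (sumenv (fun _ : 'I_1 => s : group_structure G) p) (cU D).
    by apply/integer_code_U/(power_ofP bA bB) => //; split=> //; exists k.
  exists (in_dom (G := D) Us); apply: (mulrz_inj_basis bA t0).
  by rewrite -nuP.
- move=> x y; rewrite -(nu_eq _ _ _ (comm x) (nuP x)) /dom_eq.
  exact: sat_formula_of.
- move=> f xs y; rewrite /dom_fun sat_formula_of.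
  case: f xs => xs /=; rewrite /flat /=.
  + apply: nu_eq; last by rewrite wr_topM !nuP mulrzDr.
    by rewrite mulgA -comm -!mulgA -comm.
  + exact: (exponent_mulP bA bB t0 (nuP _) (nuP _) (nuP _)).
  + by apply: nu_eq; rewrite ?mul1g ?mulg1 // mulr0z.
  + by apply: nu_eq.
- by case.
Qed.

End IntegerCodeWreath.

(** * Evaluation of base elements at integer points *)

Section ScalarMultiplication.
Local Open Scope group_scope.
Context (G : groupType).
Local Notation M := (group_structure G).

(** For [r = t^k]: [y = k x] modulo [q - 1] for every power [q <> 1] of [t]. *)
Definition scalar_mul (t r x y : G) : Prop :=
  in_base y /\ forall q q', power_of t q -> q <> 1 -> power_of t q' ->
    exponent_mul t q r q' ->
    exists z z', in_base z /\ in_base z' /\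
      gcomm q' x = gcomm q z /\ z * y^-1 = gcomm q z'.

Lemma def_scalar_mul X (f1 f2 f3 f4 : (X -> M) -> M) :
  tdefinable f1 -> tdefinable f2 -> tdefinable f3 -> tdefinable f4 ->
  definable (fun e => scalar_mul (f1 e : G) (f2 e) (f3 e) (f4 e)).
Proof. by move=> t1 t2 t3 t4; rewrite /scalar_mul; defn. Qed.

End ScalarMultiplication.

Section ScalarMultiplicationWreath.
Local Open Scope ring_scope.
Context (A B : zmodType) (n m' : nat) (bA : basis A n) (bB : basis B m'.+1).
Local Notation G := (wreath B A).
Implicit Types (f g h : {malg B[A]}) (a b : A) (k : int) (r s t : G).

Lemma dshift_inj a f g : a <> 0 -> dshift a f = dshift a g -> f = g.
Proof.
move=> a0 E; apply/eqP; rewrite -subr_eq0; apply/eqP; apply: (shift_fixed bA a0).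
by apply/eqP; rewrite -subr_eq0 -/(dshift _ _) dshiftB E subrr.
Qed.

(** A functional whose weight is the indicator of a residue class modulo [N] in [A] kills the
    multiples of [a^N - 1]. For large [N] the class of [x0] meets the support of [f] in [x0]
    only. *)
Lemma dshift_residual a f :
  (forall k, k <> 0 -> exists z, f = dshift (a *~ k) z) -> f = 0.
Proof.
move=> Hf; apply/malgP => x0; rewrite mcoeff0; apply/eqP/negPn/negP => fx0.
(* Larger than every coordinate difference between [x0] and a point of the support, so divisibility
   by [N] forces such a difference to be 0. *)
pose N := (\sum_(y <- msupp f) \sum_(i < n) `|crd bA (y - x0) i|).+1%N.
have [|z Ez] := Hf N%:Z; first by [].
have [j fj] := basis_neq0P bB (elimN eqP fx0).
pose w y : int := [forall i, (N%:Z %| crd bA (y - x0) i)%Z]%:Z.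
have : functional bB j w (dshift (a *~ N%:Z) z) = 0.
  rewrite functionalB functional_shift; set w' := (X in functional _ _ X _).
  suff -> : w' = w by rewrite subrr.
  apply: functional_extensionality => y; rewrite /w' /w; congr (_%:Z).
  congr (nat_of_bool _); apply: eq_forallb => i.
  by rewrite -addrA crdD crdMz rpredDl ?dvdz_mull.
rewrite -Ez /functional (big_fsetD1 x0) /=; last by rewrite -mcoeff_neq0.
rewrite big_seq big1 ?addr0; last first.
  move=> y; rewrite !inE => /andP[yx0 yf].
  suff -> : w y = 0 by rewrite mulr0.
  rewrite /w; case: forallP => // dvd; case/negP: yx0; apply/eqP.
  apply/eqP; rewrite -subr_eq0; apply/eqP; apply: (crd_inj (b := bA)).
  apply: functional_extensionality => i; rewrite crd0; apply/eqP.
  apply: contraTT (dvd i) => di; rewrite dvdzE gtnNdvd ?absz_gt0 // ltnS.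
  rewrite (big_fsetD1 y) //= (bigD1 i) //= -addnA; exact: leq_addr.
rewrite /w; have -> : [forall i, (N%:Z %| crd bA (x0 - x0) i)%Z].
  by apply/forallP => i; rewrite subrr crd0 dvdz0.
by rewrite mulr1 intz => /fj.
Qed.

Lemma scalar_mulP t r f (y : G) k : wr_top t <> 0 -> power_of t r ->
  wr_top r = wr_top t *~ k ->
  scalar_mul t r (in_wr f) y <-> y = in_wr (f *~ k).
Proof.
move=> t0 pr Er; split=> [[/in_base_ex-/(_ _ _ bA bB)[g ->] H]|->].
  congr in_wr; apply/eqP; rewrite -subr_eq0 -oppr_eq0 opprB; apply/eqP.
  apply: (dshift_residual (a := wr_top t)) => l l0.
  have [q qt Eq] := wr_topX t l; have [q' q't Eq'] := wr_topX t (l * k).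
  have pq : power_of t q by apply/(power_ofP bA bB) => //; split=> //; exists l.
  have pq' : power_of t q' by apply/(power_ofP bA bB) => //; split=> //; exists (l * k).
  have tl0 : wr_top t *~ l <> 0.
    by rewrite -(mulr0z (wr_top t)) => /(mulrz_inj_basis bA t0).
  have [| |z [z' [/in_base_ex-/(_ _ _ bA bB)[u ->]]]] := H q q' pq _ pq'.
  - by move=> q1; apply: tl0; rewrite -Eq q1.
  - exact/(exponent_mulP bA bB t0 Eq Er Eq').
  move=> [/in_base_ex-/(_ _ _ bA bB)[u' ->]].
  rewrite !gcomm_in_wr in_wrV in_wrM => -[/in_wr_inj E1 /in_wr_inj E2].
  have [s [v [Es Ev]]] := geometric_sum (wr_top t *~ l) k f.
  (* Division by [t^l - 1] is unique, so [u] is the geometric sum, which is congruent to [k f].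
     Letting [l] vary, [dshift_residual] gives the equality. *)
  have Eu : u = s.
    apply: (dshift_inj (a := wr_top t *~ l) tl0).
    by rewrite -Es -mulrzA -Eq' E1 Eq.
  exists (u' - v); rewrite dshiftB -Ev -Eq -E2 Eu.
  by rewrite opprB [RHS]addrC addrA subrK.
split; first exact: (in_base_in_wr bA bB).
move=> q q' /(power_ofP bA bB _ t0)[_ [l Eq]] _ /(power_ofP bA bB _ t0)[_ [l' Eq']].
move=> /(exponent_mulP bA bB t0 Eq Er Eq') El'.
have [s [v [Es Ev]]] := geometric_sum (wr_top t *~ l) k f.
exists (in_wr s), (in_wr v); split; first exact: (in_base_in_wr bA bB).
split; first exact: (in_base_in_wr bA bB).
split.
  by rewrite !gcomm_in_wr Eq Eq' -El' mulrzA Es.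
by rewrite in_wrV in_wrM gcomm_in_wr Eq Ev.
Qed.

End ScalarMultiplicationWreath.

Section Evaluation.
Local Open Scope ring_scope.
Context (A B : zmodType) (n m : nat) (bA : basis A n) (bB : basis B m).
Implicit Types (f g h : {malg B[A]}) (a b : A) (k w : int).
Implicit Types (c : 'I_n -> int) (v : 'I_m -> int) (z : 'I_n -> {malg B[A]}).

(** The general element of the submodule generated by the images of the operators [t_i - c_i]. *)
Definition relation_sum c z : {malg B[A]} :=
  \sum_i (shift (bA i) (z i) - z i *~ c i).

Definition delta_sum v : {malg B[A]} := \sum_j << bB j *g 0 >> *~ v j.

(** [g] takes the value [v / w] when the generator [bA i] of [A] is replaced by the
    integer [c i]. *)
Definition evaluates c w v g : Prop :=
  exists z, g *~ w = delta_sum v + relation_sum c z.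

Lemma shiftMz a f k : shift a (f *~ k) = shift a f *~ k.
Proof.
have Mn i : shift a (f *+ i) = shift a f *+ i.
  elim: i => [|i IH]; last by rewrite !mulrS shiftD IH.
  by apply/malgP => x; rewrite shiftE !mcoeff0.
by case: k => i; rewrite ?NegzE ?mulrNz -?pmulrn ?shiftN Mn.
Qed.

Lemma relation_sumD c z z' :
  relation_sum c z + relation_sum c z' = relation_sum c (fun i => z i + z' i).
Proof.
rewrite /relation_sum -big_split; apply: eq_bigr => i _ /=.
by rewrite shiftD mulrzDl opprD addrACA.
Qed.

Lemma relation_sumMz c z k :
  relation_sum c z *~ k = relation_sum c (fun i => z i *~ k).
Proof.
rewrite /relation_sum mulrz_suml; apply: eq_bigr => i _ /=.
by rewrite shiftMz mulrzBl -!mulrzA mulrC.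
Qed.

Lemma shift_relation_sum c z a :
  shift a (relation_sum c z) = relation_sum c (fun i => shift a (z i)).
Proof.
have shift_sum (F : 'I_n -> {malg B[A]}) :
    shift a (\sum_i F i) = \sum_i shift a (F i).
  elim/big_rec2: _ => [|i x y _ <-]; last by rewrite shiftD.
  by apply/malgP => x; rewrite shiftE !mcoeff0.
rewrite /relation_sum shift_sum; apply: eq_bigr => i _.
by rewrite shiftD shiftN shiftMz !shiftA [a + _]addrC.
Qed.

Lemma delta_sumD v v' : delta_sum v + delta_sum v' = delta_sum (fun j => v j + v' j).
Proof.
by rewrite /delta_sum -big_split; apply: eq_bigr => j _; rewrite mulrzDr.
Qed.

Lemma delta_sumMz v k : delta_sum v *~ k = delta_sum (fun j => v j * k).
Proof. by rewrite /delta_sum mulrz_suml; apply: eq_bigr => j _; rewrite mulrzA. Qed.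

Lemma evaluates_scale c w v g k :
  evaluates c w v g -> evaluates c (w * k) (fun j => v j * k) g.
Proof.
move=> [z Ez]; exists (fun i => z i *~ k).
rewrite mulrzA Ez mulrzDl delta_sumMz; congr (_ + _); exact: relation_sumMz.
Qed.

Lemma evaluatesD c w v v' f g :
  evaluates c w v f -> evaluates c w v' g ->
  evaluates c w (fun j => v j + v' j) (f + g).
Proof.
move=> [z Ez] [z' Ez']; exists (fun i => z i + z' i).
by rewrite mulrzDl Ez Ez' addrACA; congr (_ + _);
  [exact: delta_sumD|exact: relation_sumD].
Qed.

Section Existence.
Context (c : 'I_n -> int) (c0 : forall i, c i <> 0).

(** Modulo the relations [a] acts as the rational number [k' / k], written without denominators. *)
Definition scalar_mod a : Prop :=
  exists k k', [/\ k <> 0, k' <> 0 &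
    forall x, exists z, shift a x *~ k = x *~ k' + relation_sum c z].

Lemma relation_sum0 : relation_sum c (fun=> 0) = 0.
Proof.
rewrite /relation_sum big1 // => i _; rewrite mul0rz subr0.
by apply/malgP => x; rewrite shiftE !mcoeff0.
Qed.

Lemma mulz_neq0 k k' : k <> 0 -> k' <> 0 -> k * k' <> 0.
Proof. by move=> /eqP k0 /eqP k'0; apply/eqP; rewrite mulf_neq0. Qed.

Lemma scalar_mod0 : scalar_mod 0.
Proof.
exists 1, 1; split=> // x; exists (fun=> 0).
by rewrite shift0 relation_sum0 addr0.
Qed.

Lemma scalar_modD a b : scalar_mod a -> scalar_mod b -> scalar_mod (a + b).
Proof.
move=> [k [k' [k0 k'0 Ha]]] [l [l' [l0 l'0 Hb]]].
exists (k * l), (k' * l'); split; try exact: mulz_neq0.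
move=> x; have [z Ez] := Hb x; have [y Ey] := Ha x.
exists (fun i => y i *~ l' + shift a (z i) *~ k).
have -> : shift (a + b) x *~ (k * l) = shift a (shift b x *~ l) *~ k.
  by rewrite shiftMz shiftA -mulrzA mulrC.
have swap : shift a x *~ l' *~ k = shift a x *~ k *~ l' by rewrite -!mulrzA mulrC.
rewrite Ez shiftD shiftMz mulrzDl swap Ey mulrzDl -mulrzA shift_relation_sum.
rewrite -addrA; congr (_ + _); rewrite -relation_sumD.
by congr (_ + _); exact: relation_sumMz.
Qed.

Lemma scalar_modN a : scalar_mod a -> scalar_mod (- a).
Proof.
move=> [k [k' [k0 k'0 Ha]]]; exists k', k; split=> // x.
have [z Ez] := Ha (shift (- a) x).
exists (fun i => z i *~ -1).
rewrite -relation_sumMz mulrN1z.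
by move: Ez; rewrite shiftA subrr shift0 => ->; rewrite addrK.
Qed.

Lemma scalar_modP a : scalar_mod a.
Proof.
have basis_mod i : scalar_mod (bA i).
  exists 1, (c i); split=> // x.
  exists (fun j => if j == i then x else 0).
  rewrite /relation_sum (bigD1 i) //= eqxx big1 ?addr0 => [|j /negbTE ->].
    by rewrite mulr1z addrC subrK.
  rewrite mul0rz subr0; by apply/malgP => y; rewrite shiftE !mcoeff0.
rewrite -(crdK bA a); apply: big_ind; [exact: scalar_mod0|exact: scalar_modD|].
move=> i _; have pos (l : nat) : scalar_mod (bA i *+ l).
  elim: l => [|l IH]; first by rewrite mulr0n; exact: scalar_mod0.
  by rewrite mulrS; exact: scalar_modD.
case: (crd bA a i) => l; first exact: pos.
by rewrite NegzE mulrNz; apply: scalar_modN; exact: pos.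
Qed.

(** A monomial at [a] is the translate by [a] of one at 0, and translation is a rational scalar by
    [scalar_modP]; sums are brought to a common denominator. *)
Lemma evaluates_exists g : exists w v, w <> 0 /\ evaluates c w v g.
Proof.
rewrite [g]monalgE; elim/big_ind: _ => [|f h|a _].
- exists 1, (fun=> 0); split=> //; exists (fun=> 0); rewrite relation_sum0.
  by rewrite /delta_sum big1 ?addr0 ?mul0rz // => j _; rewrite mulr0z.
- move=> [w [v [w0 Ef]]] [w' [v' [w'0 Eh]]].
  exists (w * w'), (fun j => v j * w' + v' j * w); split; first exact: mulz_neq0.
  apply: evaluatesD; first exact: evaluates_scale.
  by rewrite mulrC; exact: evaluates_scale.
- have [k [k' [k0 k'0 H]]] := scalar_modP a.
  have [z Ez] := H << g@_a *g 0 >>.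
  exists k, (fun j => crd bB g@_a j * k'); split=> //; exists z.
  have -> : << g@_a *g a >> = shift a << g@_a *g 0 >>.
    by apply/malgP => x; rewrite shiftE !mcoeffU [0 == _]eq_sym subr_eq0 [x == a]eq_sym.
  rewrite Ez; congr (_ + _); rewrite -delta_sumMz; congr (_ *~ _).
  rewrite -{1}(crdK bB g@_a) /comb raddf_sum; apply: eq_bigr => j _.
  exact: raddfMz.
Qed.

End Existence.
End Evaluation.

(** * Base elements are separated by their evaluations *)

Section Separation.
Local Open Scope ring_scope.
Context (A B : zmodType) (n m : nat) (bA : basis A n) (bB : basis B m).
Implicit Types (f g h : {malg B[A]}) (a b : A).

(** For nonzero [c_i], the homomorphism from [A] to the nonzero rationals sending the [i]-th basis
    vector to [c_i]. *)
Definition character (c : 'I_n -> int) (a : A) : rat :=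
  \prod_i ((c i)%:~R ^ crd bA a i).

Lemma characterD c a b : (forall i, c i <> 0) ->
  character c (a + b) = character c a * character c b.
Proof.
move=> c0; rewrite -big_split; apply: eq_bigr => i _ /=.
by rewrite crdD expfzDr // intr_eq0; apply/eqP.
Qed.

Lemma character_basis c i : character c (bA i) = (c i)%:~R.
Proof.
rewrite /character (bigD1 i) //= crd_basis eqxx expr1z big1 ?mulr1 // => j ij.
by rewrite crd_basis eq_sym (negbTE ij) expr0z.
Qed.

Lemma character0 c : character c 0 = 1.
Proof. by rewrite /character big1 // => i _; rewrite crd0 expr0z. Qed.

Lemma functional_relation_sum j c z : (forall i, c i <> 0) ->
  functional bB j (character c) (relation_sum bA c z) = 0.
Proof.
move=> c0; rewrite /relation_sum functional_sum big1 // => i _.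
rewrite functionalB functional_shift functionalMz -functionalZw.
suff -> : (fun x => character c (bA i + x)) = (fun x => (c i)%:~R * character c x).
  by rewrite subrr.
by apply: functional_extensionality => x; rewrite characterD // character_basis.
Qed.

Lemma functional_delta_sum j c v :
  functional bB j (character c) (delta_sum A bB v) = (v j)%:~R.
Proof.
rewrite /delta_sum functional_sum (bigD1 j) //= big1 => [|i ij].
  by rewrite functionalMz functional_delta crd_basis eqxx character0 !mulr1 addr0.
by rewrite functionalMz functional_delta crd_basis (negbTE ij) mul0r mulr0.
Qed.

Lemma poly_nonroot (p : {poly int}) : p != 0 -> exists M : nat, p.[M%:Z] != 0.
Proof.
move=> p0; apply: NNPP => H.
have := max_poly_roots (p := p) (rs := [seq i%:Z | i <- iota 0 (size p)]) p0.
rewrite size_map size_iota ltnn map_inj_uniq ?iota_uniq; last by move=> i j [].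
suff -> : all (root p) [seq i%:Z | i <- iota 0 (size p)] by move=> /(_ isT isT).
apply/allP => _ /mapP[i _ ->]; apply/negPn/negP => ri; apply: H.
by exists i.
Qed.

(** The value at [M] of the polynomial with the coordinates of [a] as coefficients. Since a product
    of nonzero polynomials has finitely many roots, some [M] keeps given nonzero elements away from
    level 0. *)
Definition level (M : nat) (a : A) : int := \sum_i crd bA a i * M%:Z ^+ i.

Lemma levelB M a b : level M (a - b) = level M a - level M b.
Proof. by rewrite -sumrB; apply: eq_bigr => i _; rewrite crdB mulrBl. Qed.

Lemma level_neq0 (s : seq A) : exists M, forall a, a \in s -> a != 0 -> level M a != 0.
Proof.
pose P a : {poly int} := \sum_(i < n) (crd bA a i)%:P * 'X^i.
have P0 a : a != 0 -> P a != 0.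
  move=> /eqP /(basis_neq0P bA)[i ai]; apply/eqP => /(congr1 (fun p : {poly int} => p`_i)).
  rewrite coef0 coef_sum (bigD1 i) //= coefCM coefXn eqxx mulr1 big1 ?addr0 // => j ij.
  by rewrite coefCM coefXn eq_sym val_eqE (negbTE ij) mulr0.
have [|M HM] := @poly_nonroot (\prod_(a <- s | a != 0) P a).
  by rewrite prodf_seq_neq0; apply/allP => a _; apply/implyP/P0.
exists M => a as_ a0; move: HM.
rewrite horner_prod prodf_seq_neq0 => /allP/(_ _ as_)/implyP/(_ a0).
rewrite /P horner_sum; congr (_ != 0); apply: eq_bigr => i _.
by rewrite hornerM hornerC hornerXn.
Qed.

Lemma character_level (M N : nat) a :
  character (fun i => 2 ^+ (M ^ i * N)) a = (2 ^ level M a) ^+ N.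
Proof.
have two0 : (2 : rat) != 0 by [].
rewrite /level; have -> : 2 ^ (\sum_i crd bA a i * M%:Z ^+ i) =
    \prod_i (2 : rat) ^ (crd bA a i * M%:Z ^+ i).
  by elim/big_rec2: _ => [|i x y _ <-]; rewrite ?expr0z // expfzDr.
rewrite -prodrXl; apply: eq_bigr => i _.
rewrite rmorphXn /= [_ ^+ (M ^ i * N)]exprnP [RHS]exprnP !exprz_exp; congr (_ ^ _).
by rewrite PoszM -natz natrX natz; ring.
Qed.

(** Evaluating at [c i = 2^(M^i N)] for all [N] gives the power sums of the distinct
    numbers [2^(level M a)], weighted by the coefficients of [h]. *)
Lemma evaluation_residual h :
  (forall c j, (forall i, c i <> 0) -> functional bB j (character c) h = 0) -> h = 0.
Proof.
move=> Hh; apply/malgP => a0; rewrite mcoeff0; apply/eqP/negPn/negP => ha0.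
have [j hj] := basis_neq0P bB (elimN eqP ha0).
pose S := enum_fset (msupp h).
have [M HM] := level_neq0 [seq a - a0 | a <- S].
pose x a : rat := 2 ^ level M a.
have power_sum N : \sum_(a <- S) (crd bB h@_a j)%:~R * x a ^+ N = 0.
  transitivity (functional bB j (character (fun i => 2 ^+ (M ^ i * N))) h).
    by apply: eq_bigr => a _; rewrite character_level.
  by apply: Hh => i; apply/eqP; rewrite expf_neq0.
have poly_sum (q : {poly rat}) : \sum_(a <- S) (crd bB h@_a j)%:~R * q.[x a] = 0.
  under eq_bigr => a _ do rewrite horner_coef mulr_sumr.
  rewrite exchange_big big1 //= => i _.
  under eq_bigr => a _ do rewrite mulrCA.
  by rewrite -mulr_sumr power_sum mulr0.
(* The unnormalised Lagrange polynomial at [x a0]: its weighted sum isolates the coefficient of [a0]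
   and replaces a Vandermonde determinant. *)
pose q := \prod_(a <- S | a != a0) ('X - (x a)%:P).
have a0S : a0 \in S by change (a0 \in msupp h); rewrite -mcoeff_neq0.
have := poly_sum q; rewrite (bigD1_seq a0) ?fset_uniq //= big1_seq ?addr0; last first.
  move=> a /andP[aa0 aS]; apply/eqP; rewrite mulf_eq0 /q horner_prod prodf_seq_eq0.
  by apply/orP; right; apply/hasP; exists a; rewrite // aa0 hornerXsubC subrr eqxx.
move/eqP; rewrite mulf_eq0 intr_eq0 => /orP[/eqP //|].
rewrite /q horner_prod; apply/negP.
rewrite prodf_seq_neq0; apply/allP => a aS; apply/implyP => aa0.
rewrite hornerXsubC subr_eq0; apply/eqP => /ieexprIz.
have two1 : (2 : rat) != 1 by [].
move=> /(_ isT two1) E.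
have : level M (a - a0) != 0.
  by apply: HM; [apply: (map_f (fun a => a - a0))|rewrite subr_eq0].
by rewrite levelB E subrr eqxx.
Qed.

(** Character functionals kill the relations, so [evaluates] determines their values. One inclusion
    is enough because [f] has a value at every point, which [g] must then share. *)
Lemma evaluates_inj f g :
  (forall c w v, (forall i, c i <> 0) -> w <> 0 ->
    evaluates bA bB c w v f -> evaluates bA bB c w v g) -> f = g.
Proof.
move=> H; apply/eqP; rewrite -subr_eq0; apply/eqP; apply: evaluation_residual.
move=> c j c0; have [w [v [w0 Ef]]] := evaluates_exists bA bB c0 f.
have value k : evaluates bA bB c w v k ->
    w%:~R * functional bB j (character c) k = (v j)%:~R.
  move=> [z Ez]; rewrite -functionalMz Ez functionalD functional_relation_sum //.
  by rewrite functional_delta_sum addr0.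
have /(mulfI _) E := etrans (value _ Ef) (esym (value _ (H _ _ _ c0 w0 Ef))).
rewrite functionalB E ?subrr // intr_eq0; exact/eqP.
Qed.

End Separation.

(** * Decoding inside the wreath product *)

Section Profile.
Local Open Scope group_scope.
Context (G : groupType) (n' m' : nat).
Local Notation M := (group_structure G).
Local Notation n := n'.+1.
Local Notation m := m'.+1.
Implicit Types (t c z : 'I_n -> G) (e v : 'I_m -> G) (g s w x : G).

Definition gprod k (F : 'I_k -> G) : G := \big[*%g/1]_(i < k) F i.

Lemma tdef_gprod k X (F : 'I_k -> (X -> M) -> M) :
  (forall i, tdefinable (F i)) -> tdefinable (fun u => gprod (fun i => F i u) : M).
Proof.
move=> HF; rewrite /gprod; elim: (index_enum _) => [|i l IH].
  by apply: tdef_ext (@tdefG_1 G X) => u; rewrite big_nil.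
by apply: tdef_ext (tdefG_mul (HF i) IH) => u; rewrite big_cons.
Qed.

(** The group-theoretic form of [evaluates], with [c], [w], [v] replaced by powers of
    [t ord0]. *)
Definition group_evaluates t e c w v g : Prop :=
  w <> 1 /\ exists gw, scalar_mul (t ord0) w g gw /\
  exists ve : 'I_m -> G, (forall j, scalar_mul (t ord0) (v j) (e j) (ve j)) /\
  exists z cz : 'I_n -> G,
    (forall i, in_base (z i) /\ scalar_mul (t ord0) (c i) (z i) (cz i)) /\
    gw = gprod ve * gprod (fun i => t i * z i * (t i)^-1 * (cz i)^-1).

Lemma def_group_evaluates X (t c : 'I_n -> (X -> M) -> M) (e v : 'I_m -> (X -> M) -> M)
    (w g : (X -> M) -> M) :
  (forall i, tdefinable (t i)) -> (forall j, tdefinable (e j)) ->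
  (forall i, tdefinable (c i)) -> tdefinable w -> (forall j, tdefinable (v j)) ->
  tdefinable g ->
  definable (fun u => group_evaluates (fun i => t i u) (fun j => e j u)
    (fun i => c i u) (w u) (fun j => v j u) (g u)).
Proof.
move=> tt te tc tw tv tg; rewrite /group_evaluates.
by repeat first [apply: def_scalar_mul
  | apply: tdefG_mul; [apply: tdef_gprod|apply: tdef_gprod] | def_step].
Qed.

(** All exponents of a profile share one index type, so that a single block quantifier ranges over
    them. *)
Definition profile_index : finType := ('I_n + ('I_m + 'I_m) + bool)%type.

(** [r] lists exponents [c], [v], [v'], [w], [w'] as powers of [t ord0]; the second
    evaluation concerns [e ord0] shifted by the [A]-component of [x]. *)
Definition profile t e (r : profile_index -> G) x : Prop :=
  exists g s, in_base g /\ s * t ord0 = t ord0 * s /\ x = g * s /\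
    group_evaluates t e (fun i => r (inl (inl i))) (r (inr true))
      (fun j => r (inl (inr (inl j)))) g /\
    group_evaluates t e (fun i => r (inl (inl i))) (r (inr false))
      (fun j => r (inl (inr (inr j)))) (s * e ord0 * s^-1).

Lemma def_profile X (t : 'I_n -> (X -> M) -> M) (e : 'I_m -> (X -> M) -> M)
    (r : profile_index -> (X -> M) -> M) (x : (X -> M) -> M) :
  (forall i, tdefinable (t i)) -> (forall j, tdefinable (e j)) ->
  (forall k, tdefinable (r k)) -> tdefinable x ->
  definable (fun u => profile (fun i => t i u) (fun j => e j u) (fun k => r k u) (x u)).
Proof.
move=> tt te tr tx; rewrite /profile.
by repeat first [apply: def_group_evaluates | def_step].
Qed.

End Profile.

Section ProfileWreath.
Local Open Scope ring_scope.
Context (A B : zmodType) (n' m' : nat) (bA : basis A n'.+1) (bB : basis B m'.+1).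
Local Notation n := n'.+1.
Local Notation m := m'.+1.
Local Notation G := (wreath B A).
Implicit Types (f g : {malg B[A]}) (a : A) (x y s : G).

Definition top_gen (i : 'I_n) : G := Wreath 0 (bA i).
Definition base_gen (j : 'I_m) : G := in_wr << bB j *g 0 >>.

Lemma gprod_in_wr k (F : 'I_k -> {malg B[A]}) :
  gprod (fun i => in_wr (F i)) = in_wr (\sum_i F i).
Proof. by rewrite /gprod; elim/big_rec2: _ => // i x f _ ->; rewrite in_wrM. Qed.

Lemma group_evaluatesP (c : 'I_n -> G) (w : G) (v : 'I_m -> G)
    (kc : 'I_n -> int) (kw : int) (kv : 'I_m -> int) f :
  (forall i, power_of (top_gen ord0) (c i) /\ wr_top (c i) = bA ord0 *~ kc i) ->
  power_of (top_gen ord0) w /\ wr_top w = bA ord0 *~ kw ->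
  (forall j, power_of (top_gen ord0) (v j) /\ wr_top (v j) = bA ord0 *~ kv j) ->
  group_evaluates top_gen base_gen c w v (in_wr f) <->
  kw <> 0 /\ evaluates bA bB kc kw kv f.
Proof.
move=> Hc [pw Ew] Hv; have t0 : wr_top (top_gen ord0) <> 0 by exact: basis_vec_neq0.
have w1 : w <> 1%g <-> kw <> 0.
  apply: not_iff_compat; split=> [E|E].
    apply: (mulrz_inj_basis bA (basis_vec_neq0 (b := bA) (i := ord0))).
    by rewrite -Ew E mulr0z.
  apply: (commuting_eq bA t0); rewrite ?mul1g ?mulg1 ?Ew ?E ?mulr0z //.
  by case: pw.
have term i g cz : cz = in_wr (g *~ kc i) ->
    (top_gen i * in_wr g * (top_gen i)^-1 * cz^-1)%g =
    in_wr (shift (bA i) g - g *~ kc i).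
  by move=> ->; rewrite conj_in_wr in_wrV in_wrM.
split=> [[/w1 w0 [gw [Egw [ve [Hve [z [cz [Hz E]]]]]]]]|[w0 [z Ez]]].
  split=> //; have [z' Ez'] : exists z' : 'I_n -> {malg B[A]}, forall i, z i = in_wr (z' i).
    have P i := constructive_indefinite_description _ (in_base_ex bA bB (Hz i).1).
    by exists (fun i => proj1_sig (P i)) => i; exact: (proj2_sig (P i)).
  exists z'.
  move: Egw => /(scalar_mulP bA bB f gw t0 pw Ew) Egw.
  apply: (@in_wr_inj A B); rewrite -Egw E -in_wrM; congr (_ * _)%g.
    rewrite /delta_sum -gprod_in_wr; congr gprod; apply: functional_extensionality => j.
    by apply/(scalar_mulP bA bB _ _ t0 (Hv j).1 (Hv j).2)/Hve.
  rewrite /relation_sum -gprod_in_wr; congr gprod; apply: functional_extensionality => i.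
  rewrite Ez'; apply: term; have := (Hz i).2.
  by rewrite Ez' => /(scalar_mulP bA bB _ _ t0 (Hc i).1 (Hc i).2).
split; first exact/w1.
exists (in_wr (f *~ kw)); split; first exact/(scalar_mulP bA bB f _ t0 pw Ew).
exists (fun j => in_wr (<< bB j *g 0 >> *~ kv j)); split=> [j|].
  exact/(scalar_mulP bA bB _ _ t0 (Hv j).1 (Hv j).2).
exists (fun i => in_wr (z i)), (fun i => in_wr (z i *~ kc i)); split=> [i|].
  split; first exact: (in_base_in_wr bA bB).
  exact/(scalar_mulP bA bB _ _ t0 (Hc i).1 (Hc i).2).
rewrite gprod_in_wr Ez -in_wrM; congr (_ * _)%g.
rewrite /relation_sum -gprod_in_wr; congr gprod; apply: functional_extensionality => i.
by apply/esym/term.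
Qed.

Definition top_power (k : int) : G := Wreath 0 (bA ord0 *~ k).

Lemma in_top_comm a b : (Wreath 0 a * Wreath 0 b = Wreath 0 b * Wreath 0 a :> G)%g.
Proof.
have shift_0 c : shift c 0 = 0 :> {malg B[A]}.
  by apply/malgP => x; rewrite shiftE !mcoeff0.
by apply: wreathP; rewrite ?wr_topM ?wr_baseM /= ?shift_0 // addrC.
Qed.

Lemma top_powerP k : power_of (top_gen ord0) (top_power k).
Proof.
apply/(power_ofP bA bB); first exact: basis_vec_neq0.
by split; [exact: in_top_comm|exists k].
Qed.

Lemma power_of_top (r : G) k : power_of (top_gen ord0) r -> wr_top r = bA ord0 *~ k ->
  r = top_power k.
Proof.
move=> [rt _] Er; apply: (commuting_eq (t := top_gen ord0) bA) => //.
  exact: basis_vec_neq0.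
exact: in_top_comm.
Qed.

Definition exponents (c : 'I_n -> int) (w w' : int) (v v' : 'I_m -> int)
    (k : profile_index n' m') : G :=
  match k with
  | inl (inl i) => top_power (c i)
  | inl (inr (inl j)) => top_power (v j)
  | inl (inr (inr j)) => top_power (v' j)
  | inr b => top_power (if b then w else w')
  end.

Lemma profileP c (w w' : int) (v v' : 'I_m -> int) x :
  profile top_gen base_gen (exponents c w w' v v') x <->
  (w <> 0 /\ evaluates bA bB c w v (wr_base x)) /\
  (w' <> 0 /\ evaluates bA bB c w' v' (shift (wr_top x) << bB ord0 *g 0 >>)).
Proof.
have pP k : power_of (top_gen ord0) (top_power k) /\ wr_top (top_power k) = bA ord0 *~ k.
  by split; [exact: top_powerP|].
pose s : G := Wreath 0 (wr_top x).
have Ex : x = (in_wr (wr_base x) * s)%g.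
  by case: x @s => f a; apply: wreathP; rewrite ?wr_baseM ?wr_topM /= ?shift0 ?addr0 ?add0r.
(* The group is the semidirect product of the base group and the centraliser of the first generator,
   so the factorisation in [profile] is unique. *)
have main (g s' : G) : in_base g -> (s' * top_gen ord0 = top_gen ord0 * s')%g ->
    x = (g * s')%g -> g = in_wr (wr_base x) /\ s' = s.
  move=> /(in_base_ex bA bB)[f ->] st Exs.
  have Es : s' = s.
    apply: (commuting_eq (t := top_gen ord0) bA) => //; first exact: basis_vec_neq0.
      exact: in_top_comm.
    by rewrite /s Exs /= add0r.
  by split=> //; apply: (mulIg s'); rewrite -Exs Es.
rewrite -(group_evaluatesP (wr_base x) (fun i => pP (c i)) (pP w) (fun j => pP (v j))).
rewrite -(group_evaluatesP _ (fun i => pP (c i)) (pP w') (fun j => pP (v' j))).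
have -> : in_wr (shift (wr_top x) << bB ord0 *g 0 >>) = (s * base_gen ord0 * s^-1)%g.
  by rewrite conj_in_wr.
split=> [[g [s' [bg [st [Exs [E1 E2]]]]]]|[E1 E2]].
  by have [Eg Es] := main g s' bg st Exs; rewrite -Eg -Es.
exists (in_wr (wr_base x)), s; split; first exact: (in_base_in_wr bA bB).
by split; first exact: in_top_comm.
Qed.

(** One half of a profile determines the base component, the other a delta function located at the
    [A]-component. While one half is varied, the other is filled by [evaluates_exists]. *)
Lemma profile_inj x y :
  (forall r : profile_index n' m' -> G, (forall k, power_of (top_gen ord0) (r k)) ->
     profile top_gen base_gen r x -> profile top_gen base_gen r y) -> x = y.
Proof.
move=> H.
have step c w w' v v' : w <> 0 -> w' <> 0 ->
    evaluates bA bB c w v (wr_base x) ->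
    evaluates bA bB c w' v' (shift (wr_top x) << bB ord0 *g 0 >>) ->
    evaluates bA bB c w v (wr_base y) /\
    evaluates bA bB c w' v' (shift (wr_top y) << bB ord0 *g 0 >>).
  move=> w0 w'0 E E'.
  have px : profile top_gen base_gen (exponents c w w' v v') x by apply/profileP.
  have pr : forall k, power_of (top_gen ord0) (exponents c w w' v v' k).
    by move=> [[i|[j|j]]|b]; exact: top_powerP.
  by have /profileP[[_ ?] [_ ?]] := H _ pr px.
have E1 : wr_base x = wr_base y.
  apply: (evaluates_inj (bA := bA) (bB := bB)) => c w v c0 w0 E.
  have [w' [v' [w'0 E']]] :=
    evaluates_exists bA bB c0 (shift (wr_top x) << bB ord0 *g 0 >>).
  by have [] := step _ _ _ _ _ w0 w'0 E E'.
have E2 : shift (wr_top x) << bB ord0 *g 0 >> = shift (wr_top y) << bB ord0 *g 0 >>.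
  apply: (evaluates_inj (bA := bA) (bB := bB)) => c w v c0 w0 E.
  have [w' [v' [w'0 E']]] := evaluates_exists bA bB c0 (wr_base x).
  by have [] := step _ _ _ _ _ w'0 w0 E' E.
apply: wreathP => //; apply/esym/eqP; rewrite -subr_eq0 -oppr_eq0 opprB eq_sym.
have := congr1 (fun f => f@_(wr_top x)) E2; rewrite !shiftE !mcoeffU subrr eqxx.
by case: (0 == _) => // /basis_vec_neq0.
Qed.

End ProfileWreath.

(** * The definable decoder and its correctness for the standard basis *)

Section Decoder.
Local Open Scope ring_scope.
Context (A B : zmodType) (n' m' : nat) (bA : basis A n'.+1) (bB : basis B m'.+1).
Local Notation n := n'.+1.
Local Notation m := m'.+1.
Local Notation G := (wreath B A).
Local Notation Z := (ring_structure int).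
Local Notation M := (group_structure G).
Local Notation S := (profile_index n' m').
Local Notation i0 := (lshift m (ord0 : 'I_n)).
Local Notation C := (wreath_code n m).
Local Notation D := (integer_code G i0).
Local Notation K := (comp_code C D).
Local Notation par := (@outer_par _ _ _ C D M).

Definition std_par (h : 'I_(n + m)) : G :=
  match split h with inl i => top_gen B bA i | inr j => base_gen A bB j end.

Lemma std_par_top i : std_par (lshift m i) = top_gen B bA i.
Proof. by rewrite /std_par (unsplitK (inl i)). Qed.

Lemma std_par_base j : std_par (rshift n j) = base_gen A bB j.
Proof. by rewrite /std_par (unsplitK (inr j)). Qed.

Lemma decode_wreath_crd (y : 'I_n.+1 -> int) (i : 'I_n) :
  y (lift ord0 i) = crd bA (wr_top (decode_wreath bA bB y)) i.
Proof. by rewrite combK. Qed.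

(** Nonnegativity lets these codes be inserted into formulas as closed terms. It holds since
    canonical codes are nonnegative and generators have coordinates 0 and 1. *)
Lemma std_codes : exists q : 'I_(n + m) -> 'I_n.+1 -> int, forall h,
  [/\ canonical n m (q h ord0), decode_wreath bA bB (q h) = std_par h & forall i, 0 <= q h i].
Proof.
pose P h := constructive_indefinite_description _
  (let: ex_intro2 y cy Ey := decode_wreath_surj bA bB (std_par h) in
   ex_intro (fun y => canonical n m (y ord0) /\ decode_wreath bA bB y = std_par h) y (conj cy Ey)).
exists (fun h => proj1_sig (P h)) => h; case: (P h) => y /= [cy Ey]; split=> // i.
case: (unliftP ord0 i) => [j|] ->; last by have [/nonnegP] := cy.
rewrite decode_wreath_crd Ey /std_par; case: (split h) => k /=; last by rewrite crd0.
by rewrite crd_basis.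
Qed.

Lemma zero_code : exists2 y : int, canonical n m y & decode bA bB y = 0.
Proof. exact: decode_surj. Qed.

(** Translate the group formula for [profile] along [wreath_code], with constants for the generators
    and with every exponent [k] replaced by the code of the corresponding [top_power]. *)
Lemma profile_formula : exists chi : formula ring_language ('I_n.+1 + S),
  forall (y : 'I_n.+1 -> Z) (k : S -> Z), canonical n m (y ord0) ->
  sat (sumenv y k) chi <->
  profile (top_gen B bA) (base_gen A bB) (fun s => top_power B bA (k s))
    (decode_wreath bA bB y).
Proof.
have [phi Hphi] : definable (fun e : ('I_(n + m) + S) + unit -> M =>
    profile (fun i => e (inl (inl (lshift m i)))) (fun j => e (inl (inl (rshift n j))))
      (fun s => e (inl (inr s)) : G) (e (inr tt))).
  by apply: def_profile => *; exact: tdef_var.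
have [q Hq] := std_codes; have [y0 cy0 Ey0] := zero_code.
(* The code of [top_power k]: zero base component, first coordinate [k], all others 0. *)
pose power_code (k : int) (i : 'I_n.+1) : Z :=
  if unlift ord0 i is Some j then if j == ord0 then k else 0 else y0.
pose code (v : ('I_(n + m) + S) + unit) (e : 'I_n.+1 + S -> Z) (i : 'I_n.+1) : Z :=
  match v with
  | inl (inl h) => q h i
  | inl (inr s) => power_code (e (inr s)) i
  | inr _ => e (inl i)
  end.
pose p0 (i : 'I_(cpar C)) : Z := 0.
have [chi Hchi] : definable (fun e : 'I_n.+1 + S -> Z =>
    sat (sumenv (fun v : (('I_(n + m) + S) + unit) * 'I_(cdim C) => code v.1 e v.2) p0)
      (translate C phi)).
  apply: (@def_ext _ _ _ (fun e : 'I_n.+1 + S -> Z => sat (fun v =>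
    match v with inl w => code w.1 e w.2 | inr i => p0 i end) (translate C phi))).
    by [].
  apply: (def_sat _ (f := fun v e =>
    match v with inl w => code w.1 e w.2 | inr i => p0 i end)).
  move=> [[[[h|s]|u] i]|i] /=; try exact: tdef_var.
  - by apply: tdefZ_const; have [] := Hq h.
  - rewrite /power_code; case: (unlift ord0 i) => [j|].
      by case: (j == ord0); [exact: tdef_var|exact: tdefZ_0].
    by apply: tdefZ_const; have [/nonnegP] := cy0.
  - exact: tdefZ_0.
exists chi => y k cy; rewrite Hchi.
have code_can v : canonical n m (code v (sumenv y k) ord0).
  case: v => [[h|s]|u] //=; first by have [] := Hq h.
  by rewrite /power_code unlift_none.
pose E v : dom (G := C) p0 :=
  in_dom (G := C) ((wreath_code_U p0 (code v (sumenv y k))).2 (code_can v)).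
rewrite -[sumenv _ p0]/(tenv E) (sat_translate (wreath_code_coordinate bA bB p0)) Hphi /=.
have Epar h : decode_wreath bA bB (q h) = std_par h by have [] := Hq h.
have -> : (fun i => decode_wreath bA bB (q (lshift m i))) = top_gen B bA.
  by apply: functional_extensionality => i; rewrite Epar std_par_top.
have -> : (fun j => decode_wreath bA bB (q (rshift n j))) = base_gen A bB.
  by apply: functional_extensionality => j; rewrite Epar std_par_base.
suff -> : (fun s => decode_wreath bA bB (power_code (k s))) = (fun s => top_power B bA (k s)).
  by [].
apply: functional_extensionality => s; rewrite /decode_wreath /power_code unlift_none Ey0.
congr Wreath; rewrite /comb (bigD1 ord0) //= liftK eqxx big1 ?addr0 // => j /negbTE j0.
by rewrite liftK j0 mulr0z.
Qed.

Definition profile_chi : formula ring_language ('I_n.+1 + S) :=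
  proj1_sig (constructive_indefinite_description _ profile_formula).

(** Points of the copy of the integers are single group elements. Hence the same [k] serves here as
    a tuple of integers and in [decodes] as a tuple of group elements. *)
Definition profile_env (r : 'I_(cpar K) -> M) (y : 'I_(cdim K) -> M) (k : S -> M)
    (v : ('I_n.+1 + S) * 'I_1 + 'I_(n + m)) : M :=
  match v with
  | inl (inl i, j) => y (mxvec_index i j)
  | inl (inr s, _) => k s
  | inr h => par r h
  end.

(** [y] codes [x] if every profile of the element of the inner copy of [G] coded by
    [y] is a profile of [x]. *)
Definition decodes (r : 'I_(cpar K) -> M) (y : 'I_(cdim K) -> M) (x : M) : Prop :=
  sat (sumenv y r) (cU K) /\
  forall k : S -> M, (forall s, power_of (par r i0 : G) (k s)) ->
    sat (profile_env r y k) (translate D profile_chi) ->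
    profile (fun i => par r (lshift m i))
      (fun j => par r (rshift n j)) (k : S -> G) x.

Lemma def_decodes :
  definable (fun e : ('I_(cdim K) + unit) + 'I_(cpar K) -> M =>
    decodes (fun i => e (inr i)) (fun i => e (inl (inl i))) (e (inl (inr tt)))).
Proof.
rewrite /decodes /profile_env /outer_par; apply: def_and.
  apply: (@def_ext _ _ _ (fun e : ('I_(cdim K) + unit) + 'I_(cpar K) -> M =>
    sat (fun v => match v with inl i => e (inl (inl i)) | inr i => e (inr i) end) (cU K))).
    by [].
  apply: (def_sat _ (f := fun v e =>
    match v with inl i => e (inl (inl i)) | inr i => e (inr i) end)).
  by case=> i; exact: tdef_var.
apply: def_allF; apply: def_imp; first by apply: def_allS => s; defn.
apply: def_imp.
  apply: (def_sat _ (f := fun v e => profile_env (fun i => e (inr (inr i)))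
    (fun i => e (inr (inl (inl i)))) (fun s => e (inl s)) v)).
  by move=> [[[i|s] j]|h]; exact: tdef_var.
by apply: def_profile => *; exact: tdef_var.
Qed.

End Decoder.

Section DecoderCorrect.
Local Open Scope ring_scope.
Context (A B : zmodType) (n' m' : nat) (bA : basis A n'.+1) (bB : basis B m'.+1).
Local Notation n := n'.+1.
Local Notation m := m'.+1.
Local Notation G := (wreath B A).
Local Notation Z := (ring_structure int).
Local Notation M := (group_structure G).
Local Notation S := (profile_index n' m').
Local Notation i0 := (lshift m (ord0 : 'I_n)).
Local Notation C := (wreath_code n m).
Local Notation D := (integer_code G i0).
Local Notation K := (comp_code C D).
Local Notation par := (@outer_par _ _ _ C D M).

Lemma decodes_coordinate_map (r : 'I_(cpar K) -> M) : par r = std_par bA bB ->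
  exists2 mu : dom r -> M, coordinate_map mu & defines_coordinate_map mu (decodes bA bB r).
Proof.
move=> Er.
have Et : par r i0 = top_gen B bA ord0 by rewrite Er std_par_top.
have t0 : wr_top (par r i0 : G) <> 0 by rewrite Et; exact: basis_vec_neq0.
have [nu nuP nuE] := integer_code_coordinate bA bB t0.
pose q (i : 'I_(cpar C)) : dom (G := D) (par r) := False_rect _ (notF (ltn_ord (i : 'I_0))).
have inq : inner_par q by case.
have muP := wreath_code_coordinate bA bB (nu \o q).
have [mu' mu'P mu'E] := comp_coordinate_map nuP inq muP.
exists mu' => //.
(* Undoing both translations, the condition on [y] is a profile of the decoded element with respect
   to the standard basis; [profile_inj] then concludes. *)
have main (y : 'I_(cdim K) -> M) (Uy : sat (sumenv y r) (cU K)) (k : S -> M) :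
    (forall s, power_of (par r i0 : G) (k s)) ->
    sat (profile_env r y k) (translate D (profile_chi bA bB)) <->
    profile (top_gen B bA) (base_gen A bB) (k : S -> G) (mu' (in_dom (G := K) Uy)).
  move=> pk; have [ys [bys Uys]] := (sat_comp_U nuP inq y).1 Uy.
  rewrite (mu'E (in_dom (G := K) Uy) ys Uys bys).
  pose ks s : dom (G := D) (par r) := in_dom (G := D)
    ((integer_code_U (par r) (fun _ : 'I_1 => k s)).2 (pk s)).
  have -> : profile_env r y k = tenv (sumenv ys ks).
    apply: functional_extensionality => -[[[i|s] j]|h] //=.
  rewrite (sat_translate nuP).
  have -> : nu \o sumenv ys ks = sumenv (nu \o ys) (nu \o ks).
    by apply: functional_extensionality => -[].
  have cy : canonical n m (nu (ys ord0)) by move: Uys => /wreath_code_U.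
  have chiP := proj2_sig (constructive_indefinite_description _ (profile_formula bA bB)).
  rewrite (chiP (nu \o ys) (nu \o ks) cy).
  suff -> : (fun s => top_power B bA ((nu \o ks) s)) = k by [].
  apply: functional_extensionality => s; apply/esym/power_of_top.
    by rewrite -Et; exact: pk.
  by have := nuE (ks s); rewrite Et.
have Etop : (fun i => par r (lshift m i)) = top_gen B bA.
  by apply: functional_extensionality => i; rewrite Er std_par_top.
have Ebase : (fun j => par r (rshift n j)) = base_gen A bB.
  by apply: functional_extensionality => j; rewrite Er std_par_base.
move=> y x; rewrite /decodes Etop Ebase; split=> [[Uy H]|[Uy <-]].
  exists Uy; apply: (@profile_inj A B n' m' bA bB) => k pk.
  have pk' s : power_of (par r i0 : G) (k s) by rewrite Et.
  by move/(main y Uy k pk'); exact: H.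
by split=> // k pk /(main y Uy k pk).
Qed.

End DecoderCorrect.

(** * Selecting the parameters *)

Section CoordinateAxioms.
Context (G : groupType) (K : code group_language group_language).
Local Notation M := (group_structure G).
Local Notation N := (cdim K).
Context (T : ('I_(cpar K) -> M) -> ('I_N -> M) -> M -> Prop).

Definition function_axiom (f : group_symbol) (r : 'I_(cpar K) -> M) : Prop :=
  forall (ys : ('I_(group_arity f) * 'I_N)%type -> M) (xs : 'I_(group_arity f) -> M)
    (y : 'I_N -> M) (x : M),
  (forall k, T r (fun i => ys (k, i)) (xs k)) -> T r y x ->
  (sat (sumenv (sumenv ys y) r) (cF K f) <-> finterp M f xs = x).

(** Included in the formula that selects the parameters, these axioms make [T] the graph
    of a coordinate map by fiat; only one parameter tuple has to be shown to satisfy them. *)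
Definition coordinate_axioms (r : 'I_(cpar K) -> M) : Prop :=
  (forall y x, T r y x -> sat (sumenv y r) (cU K)) /\
  (forall y, sat (sumenv y r) (cU K) -> exists x, T r y x) /\
  (forall y x x', T r y x -> T r y x' -> x = x') /\
  (forall x, exists y, T r y x) /\
  (forall y y' x x', T r y x -> T r y' x' ->
    (sat (sumenv (sumenv y y') r) (cE K) <-> x = x')) /\
  function_axiom GMul r /\ function_axiom GInv r /\ function_axiom GOne r.

(** This replaces the existence of an isomorphism, which quantifies over maps, by conditions that
    are first-order as soon as [T] is definable. *)
Lemma coordinate_axiomsP (r : 'I_(cpar K) -> M) :
  coordinate_axioms r <->
  exists2 mu : dom r -> M, coordinate_map mu & defines_coordinate_map mu (T r).
Proof.
split=> [[T_U [T_ex [T_fun [T_surj [T_E [T_M [T_V T_1]]]]]]]|[mu muP muT]].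
  have ex (y : dom r) : exists x, T r (sval y) x by apply: T_ex; exact: (svalP y).
  pose mu y := proj1_sig (constructive_indefinite_description _ (ex y)).
  have muT (y : dom r) : T r (sval y) (mu y).
    exact: (proj2_sig (constructive_indefinite_description _ (ex y))).
  have fun_mu f : function_axiom f r -> forall (xs : 'I_(group_arity f) -> dom r) y,
      dom_fun (G := K) (f := f) xs y <-> finterp M f (fun i => mu (xs i)) = mu y.
    move=> H xs y.
    exact: (H (flat xs) (fun k => mu (xs k)) (sval y) (mu y) (fun k => muT (xs k)) (muT y)).
  exists mu; last first.
    move=> y x; split=> [Tyx|[Uy <-]]; last exact: (muT (in_dom Uy)).
    exists (T_U _ _ Tyx).
    exact: (T_fun y _ _ (muT (in_dom (T_U _ _ Tyx))) Tyx).
  split.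
  - move=> x; have [y Tyx] := T_surj x; exists (in_dom (T_U _ _ Tyx)).
    exact: (T_fun y _ _ (muT (in_dom (T_U _ _ Tyx))) Tyx).
  - by move=> x y; exact: (T_E _ _ _ _ (muT x) (muT y)).
  - by case; exact: fun_mu.
  - by case.
have T_U y x : T r y x -> sat (sumenv y r) (cU K) by move=> /muT[].
have T_mu y x (Uy : sat (sumenv y r) (cU K)) : T r y x -> mu (in_dom Uy) = x.
  by move=> /muT[Uy' <-]; congr mu; apply: dom_inj.
have fax f : function_axiom f r.
  move=> ys xs y x Hys Hy.
  pose d k : dom r := in_dom (T_U _ _ (Hys k)).
  have Ed : (fun k => mu (d k)) = xs.
    by apply: functional_extensionality => k; exact: T_mu.
  rewrite -(T_mu y x (T_U _ _ Hy) Hy) -Ed -(coord_fun muP (f := f)) /dom_fun /=.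
  suff -> : flat d = ys by [].
  by apply: functional_extensionality => -[].
split; first exact: T_U.
split; first by move=> y Uy; exists (mu (in_dom Uy)); apply/muT; exists Uy.
split; first by move=> y x x' Tx /muT[Uy <-]; rewrite -(T_mu y x Uy Tx).
split.
  move=> x; have [y <-] := coord_surj muP x; exists (sval y); apply/muT.
  by exists (svalP y); congr mu; apply: dom_inj.
split; last by [].
move=> y y' x x' Tx Tx'.
rewrite -(T_mu y x (T_U _ _ Tx) Tx) -(T_mu y' x' (T_U _ _ Tx') Tx').
exact: (coord_eq muP (in_dom (T_U _ _ Tx)) (in_dom (T_U _ _ Tx'))).
Qed.

Context (defT : definable (fun e : ('I_N + unit) + 'I_(cpar K) -> M =>
  T (fun i => e (inr i)) (fun i => e (inl (inl i))) (e (inl (inr tt))))).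

Lemma def_graph X (r : 'I_(cpar K) -> X) (y : 'I_N -> X) (x : X) :
  definable (fun e : X -> M => T (fun i => e (r i)) (fun i => e (y i)) (e x)).
Proof.
exact: (def_rename (fun v => match v with
  | inl (inl i) => y i | inl (inr _) => x | inr i => r i end) defT).
Qed.

Lemma def_finterp_group f X (xs : 'I_(group_arity f) -> X) (x : X) :
  definable (fun e : X -> M => finterp M f (fun k => e (xs k)) = e x).
Proof.
apply: def_eq; last exact: tdef_var.
exact: (@tdef_app group_language M X f (fun k e => e (xs k)) (fun k => tdef_var M (xs k))).
Qed.

Lemma def_coordinate_axioms :
  definable (fun e : 'I_(cpar K) -> M => coordinate_axioms e).
Proof.
have fax f : definable (fun e : 'I_(cpar K) -> M => function_axiom f e).
  rewrite /function_axiom; apply: def_allF; apply: def_allT; apply: def_allT.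
  apply: def_all; apply: def_imp.
    by apply: def_allI => k; exact: def_graph.
  apply: def_imp; first exact: def_graph.
  by apply: def_iff; [exact: def_sat_sum3|exact: def_finterp_group].
rewrite /coordinate_axioms; repeat first [exact: fax | exact: def_graph
  | exact: def_sat_sum3 | exact: def_sat_sum | def_step].
Qed.

End CoordinateAxioms.

(** * The regular bi-interpretation *)

Section Assembly.
Local Open Scope ring_scope.
Context (A B : zmodType) (n' m' : nat) (bA : basis A n'.+1) (bB : basis B m'.+1).
Local Notation n := n'.+1.
Local Notation m := m'.+1.
Local Notation G := (wreath B A).
Local Notation Z := (ring_structure int).
Local Notation M := (group_structure G).
Local Notation i0 := (lshift m (ord0 : 'I_n)).
Local Notation C := (wreath_code n m).
Local Notation D := (integer_code G i0).
Local Notation K := (comp_code C D).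
Local Notation par := (@outer_par _ _ _ C D M).

(** [wreath_code] takes no parameters, so those of the composite are the outer ones and the second
    case is empty. Axioms about the composite thus become conditions on [p]. *)
Definition comp_par_of (p : 'I_(n + m) -> M) (i : 'I_(cpar K)) : M :=
  match split (i : 'I_(n + m + 0 * 1)) with inl h => p h | inr _ => 1%g end.

Lemma comp_par_ofK p : par (comp_par_of p) = p.
Proof.
apply: functional_extensionality => h.
by rewrite /outer_par /comp_par_of /= (unsplitK (inl h)).
Qed.

Lemma parK (r : 'I_(cpar K) -> M) : comp_par_of (par r) = r.
Proof.
apply: functional_extensionality => i; rewrite /comp_par_of.
case: (splitP (i : 'I_(n + m + 0 * 1))) => [h Eh|[]//].
by rewrite /outer_par; congr r; apply: val_inj.
Qed.

(** The first condition makes [integer_code] an interpretation, the second makes [decodes] the graph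
    of an isomorphism. *)
Lemma def_parameters : definable (fun p : 'I_(n + m) -> M =>
  ~ in_base (p i0 : G) /\ coordinate_axioms (decodes bA bB) (comp_par_of p)).
Proof.
apply: def_and; first by defn.
have ax := def_coordinate_axioms (def_decodes bA bB).
apply: (def_subst (f := fun i p => comp_par_of p i) ax) => i.
rewrite /comp_par_of; case: (split _) => h; first exact: tdef_var.
exact: tdefG_1.
Qed.

Definition parameters : formula group_language 'I_(cpar D) := formula_of def_parameters.

Lemma parametersP (p : 'I_(cpar D) -> M) : sat p parameters <->
  ~ in_base (p i0 : G) /\ coordinate_axioms (decodes bA bB) (comp_par_of p).
Proof. exact: sat_formula_of. Qed.

Lemma parameters_top (p : 'I_(cpar D) -> M) : sat p parameters -> wr_top (p i0 : G) <> 0.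
Proof. by move=> /parametersP[H _] t0; apply: H; apply/(in_baseP bA bB). Qed.

Lemma parameters_std : sat (std_par bA bB : 'I_(cpar D) -> M) parameters.
Proof.
apply/parametersP; split.
  by rewrite std_par_top (in_baseP bA bB); exact: basis_vec_neq0.
apply/coordinate_axiomsP; apply: decodes_coordinate_map.
exact: comp_par_ofK.
Qed.

Definition no_condition : formula ring_language 'I_(cpar C) := Imp Bot Bot.

Lemma wreath_in_Z : regularly_interpretable M Z no_condition.
Proof.
split=> [|p _]; first by exists (fun=> 0); move.
have mu := wreath_code_coordinate bA bB p.
by split; [exact: coordinate_map_defines mu|eexists; exact: mu].
Qed.

Lemma Z_in_wreath : regularly_interpretable Z M parameters.
Proof.
split=> [|p Hp]; first by eexists; exact: parameters_std.
have [nu nuP _] := integer_code_coordinate bA bB (parameters_top Hp).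
by split; [exact: coordinate_map_defines nuP|exists nu].
Qed.

Lemma wreath_self_isomorphism :
  definable_self_isomorphism M (comp_param no_condition parameters).
Proof.
exists (formula_of (def_decodes bA bB)) => r.
move=> /sat_AndE[]; rewrite sat_rename => /parametersP[_ /coordinate_axiomsP].
rewrite parK => -[mu muP muT] _; exists mu => // y x.
by rewrite sat_formula_of.
Qed.

Local Notation K' := (comp_code D C).

(** A point of the composite codes [t^x] as soon as its [A]-coordinates are [x] times those of [t];
    the base component needs no comparison, as powers of [t] are determined by their
    [A]-components. *)
Lemma def_exponent : definable
  (fun e : ('I_(cdim K') + unit) + 'I_(cpar K') -> Z =>
    sat (sumenv (fun i => e (inl (inl i))) (fun i => e (inr i))) (cU K') /\
    forall i : 'I_n, e (inl (inl (mxvec_index (ord0 : 'I_1) (lift ord0 i)))) =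
      e (inr (comp_par (G := D) (D := C) (inl (i0, lift ord0 i)))) * e (inl (inr tt))).
Proof. by apply: def_and; [exact: def_sat_sum|defn]. Qed.

Lemma Z_self_isomorphism :
  definable_self_isomorphism Z (comp_param parameters no_condition).
Proof.
exists (formula_of def_exponent) => r Hr.
have nuP := wreath_code_coordinate bA bB (outer_par (G := D) (D := C) r).
have [_ [q [inq Hq]]] := (sat_comp_param nuP _ _).1 Hr.
have [mu muP muE] := integer_code_coordinate bA bB (parameters_top Hq).
have [mu' mu'P mu'E] := comp_coordinate_map nuP inq muP.
exists mu' => // y x; rewrite sat_formula_of /=.
have main (Uy : sat (sumenv y r) (cU K')) (k : int) : mu' (in_dom (G := K') Uy) = k <->
    forall i : 'I_n, y (mxvec_index (ord0 : 'I_1) (lift ord0 i)) =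
      r (comp_par (G := D) (D := C) (inl (i0, lift ord0 i))) * k.
  have [ys [bys Uys]] := (sat_comp_U nuP inq y).1 Uy.
  rewrite (mu'E (in_dom (G := K') Uy) ys Uys bys).
  have := muE (in_dom (G := D) Uys); set k' := mu _ => Ek'.
  have Ey i : y (mxvec_index (ord0 : 'I_1) (lift ord0 i)) =
      r (comp_par (G := D) (D := C) (inl (i0, lift ord0 i))) * k'.
    have := congr1 (fun a => crd bA a i) Ek'.
    by rewrite crdMz /= !combK => H; rewrite -bys H (inq i0).
  split=> [<-|Ek]; first exact: Ey.
  (* A nonzero coordinate of [t] can be cancelled, so the exponent is unique. *)
  have [i ti] := basis_neq0P bA (parameters_top Hq).
  apply: (mulfI (introN eqP ti)); have := Ey i; rewrite Ek.
  by rewrite -(inq i0) /= combK => ->.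
split=> [[Uy H]|[Uy]]; first by exists Uy; exact/main.
by move=> /main H; split.
Qed.

Lemma wreath_bi_interpretation : regularly_injectively_bi_interpretable M Z.
Proof.
exists C, no_condition, D, parameters; split.
- split; [exact: wreath_in_Z|exact: Z_in_wreath|exact: wreath_self_isomorphism|].
  exact: Z_self_isomorphism.
- by move=> p _ x y; exact: wreath_code_E.
- by move=> p _ x y; exact: integer_code_E.
Qed.

End Assembly.

Theorem theorem1p1 (A B : zmodType) (n m : nat)
    (n_gt0 : 0 < n) (m_gt0 : 0 < m)
    (freeA : free_abelian_of_rank A n) (freeB : free_abelian_of_rank B m) :
  regularly_injectively_bi_interpretable
    (group_structure (wreath B A)) (ring_structure int).
Proof.
case: n n_gt0 freeA => // n' _ /free_basis[bA _].
case: m m_gt0 freeB => // m' _ /free_basis[bB _].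
exact: wreath_bi_interpretation bA bB.
Qed.
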